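(* Let $K\ge 1$, $k=(K-1)/(K+1)$, and let $m,p,q\ge 1$ be integers. Let $R_{2,m,q}\in(0,1)$ be the unique root in $(0,1)$ of the equation $1-r^{2m}-r^q=0$, and let $r_{m,p,q,k}\in(0,1)$ be the smallest positive root of the equation $$-\frac{1-r^{2m}-r^q}{(1+r^m)^2}+\frac{(r^p+k)r^{p}}{1-r^p}=0 .$$ Let $f(z)=h(z)+\overline{g(z)}=\sum_{n=0}^\infty a_n z^n+\overline{\sum_{n=1}^\infty b_n z^n}$ be a sense-preserving $K$-quasiconformal harmonic mapping in $\mathbb{D}$ with $\Vert h\Vert_\infty\le 1$, and let $(\omega_j)_{j\ge 1}$ be functions with $\omega_j\in\mathcal{B}_j$ for each $j\ge1$. Then $r_{m,p,q,k}\le R_{2,m,q}$ and $$|h(\omega_m(z))|^2+|h'(\omega_m(z))|\,|\omega_q(z)|+\sum_{n=2}^\infty |a_n|\,|\omega_p(z)|^n+\sum_{n=1}^\infty |b_n|\,|\omega_p(z)|^n\le 1\qquad\text{for } |z|=r\le r_{m,p,q,k}.$$ Moreover, the radius $r_{m,p,q,k}$ cannot be improved: for every $R$ with $r_{m,p,q,k}<R<1$ there exist a sense-preserving $K$-quasiconformal harmonic mapping $f(z)=h(z)+\overline{g(z)}=\sum_{n=0}^\infty a_n z^n+\overline{\sum_{n=1}^\infty b_n z^n}$ in $\mathbb{D}$ with $\Vert h\Vert_\infty\le 1$, functions $(\omega_j)_{j\ge1}$ with $\omega_j\in\mathcal{B}_j$ for each $j\ge1$ (for the same $K,m,p,q$),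 and a point $z$ with $|z|\le R$ for which the displayed inequality $|h(\omega_m(z))|^2+|h'(\omega_m(z))|\,|\omega_q(z)|+\sum_{n=2}^\infty |a_n|\,|\omega_p(z)|^n+\sum_{n=1}^\infty |b_n|\,|\omega_p(z)|^n\le 1$ fails.
   Context: $\mathbb{D}=\{z\in\mathbb{C}:|z|<1\}$. For an analytic function $h$ in $\mathbb{D}$, $\Vert h\Vert_\infty=\sup_{z\in\mathbb{D}}|h(z)|$. $\mathcal{B}$ is the set of analytic functions $\omega$ in $\mathbb{D}$ with $\Vert\omega\Vert_\infty\le 1$, and for an integer $j\ge1$, $$\mathcal{B}_j=\{\omega\in\mathcal{B}:\ \omega(0)=\omega'(0)=\cdots=\omega^{(j-1)}(0)=0,\ \omega^{(j)}(0)\ne 0\}.$$ A harmonic mapping in $\mathbb{D}$ is written $f=h+\overline{g}$ with $h,g$ analytic in $\mathbb{D}$. It is locally univalent and sense-preserving if $|h'(z)|^2-|g'(z)|^2>0$ for all $z\in\mathbb{D}$ (in particular $h'\neq0$ in $\mathbb{D}$). For $K\ge1$ and $k=(K-1)/(K+1)\in[0,1)$, a locally univalent sense-preserving harmonic mapping $f=h+\overline g$ is called a sense-preserving $K$-quasiconformal harmonic mapping in $\mathbb{D}$ if $|g'(z)/h'(z)|\le k$ for all $z\in\mathbb{D}$. *)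

(* Defs.v *)
From Stdlib Require Import Reals.
From Coquelicot Require Import Coquelicot.

Open Scope R_scope.

Definition in_disc (z : C) : Prop := Cmod z < 1.

(** [expansion N c w l] : l = \sum_{n >= N} c_n w^n. *)
Definition expansion (N : nat) (c : nat -> C) (w l : C) : Prop :=
  @is_series C_AbsRing C_NormedModule
    (fun n => Cmult (c (N + n)%nat) (Cpow w (N + n))) l.

(** Functions on the disc are total functions on [C] whose values outside the
    disc are irrelevant.  Analyticity is taken in its literal sense: near each
    point of the disc the function is the sum of a convergent power series. *)
Definition analytic_on_disc (h : C -> C) : Prop :=
  forall z0 : C, in_disc z0 ->
    exists (c : nat -> C) (rho : R), 0 < rho /\
      forall z : C, Cmod (Cminus z z0) < rho -> expansion 0 c (Cminus z z0) (h z).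

Definition sup_norm (h : C -> C) : Rbar :=
  Lub_Rbar (fun x : R => exists z : C, in_disc z /\ x = Cmod (h z)).

(** [C_derive] is total; it is the complex derivative wherever the latter exists
    ([C_derive_correct]), hence at every point of the disc for analytic maps. *)
Definition C_derive_n (n : nat) (h : C -> C) : C -> C := Nat.iter n C_derive h.

Definition class_B (w : C -> C) : Prop :=
  analytic_on_disc w /\ Rbar_le (sup_norm w) (Finite 1).

Definition class_Bj (j : nat) (w : C -> C) : Prop :=
  class_B w /\
  (forall i : nat, (i < j)%nat -> C_derive_n i w (RtoC 0) = RtoC 0) /\
  C_derive_n j w (RtoC 0) <> RtoC 0.

Definition harmonic_map (f h g : C -> C) : Prop :=
  analytic_on_disc h /\ analytic_on_disc g /\
  forall z : C, in_disc z -> f z = Cplus (h z) (Cconj (g z)).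

Definition loc_univalent_sense_preserving (h g : C -> C) : Prop :=
  forall z : C, in_disc z ->
    Cmod (C_derive h z) ^ 2 - Cmod (C_derive g z) ^ 2 > 0.

Definition kappa (K : R) : R := (K - 1) / (K + 1).

Definition quasiconformal_harmonic (K : R) (f h g : C -> C) : Prop :=
  harmonic_map f h g /\
  loc_univalent_sense_preserving h g /\
  forall z : C, in_disc z ->
    Cmod (Cdiv (C_derive g z) (C_derive h z)) <= kappa K.

(** f = h + conj g with h = \sum_{n >= 0} a_n z^n and g = \sum_{n >= 1} b_n z^n
    in the disc, together with the remaining hypotheses on (h, (w_j)).
    The entries [b 0] and [w 0] play no role. *)
Definition admissible (K : R) (f h g : C -> C) (a b : nat -> C)
    (w : nat -> C -> C) : Prop :=
  quasiconformal_harmonic K f h g /\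
  (forall z : C, in_disc z -> expansion 0 a z (h z)) /\
  (forall z : C, in_disc z -> expansion 1 b z (g z)) /\
  Rbar_le (sup_norm h) (Finite 1) /\
  (forall j : nat, (1 <= j)%nat -> class_Bj j (w j)).

(** \sum_{n >= N} |c_n| x^n for x >= 0, in the extended reals: the partial sums
    are nondecreasing, so [Lim_seq] is their limit, [p_infty] on divergence. *)
Definition abs_sum (N : nat) (c : nat -> C) (x : R) : Rbar :=
  Lim_seq (sum_n (fun n => Cmod (c (N + n)%nat) * x ^ (N + n))).

Definition bohr_sum (m p q : nat) (h : C -> C) (a b : nat -> C)
    (w : nat -> C -> C) (z : C) : Rbar :=
  Rbar_plus
    (Rbar_plus
      (Finite (Cmod (h (w m z)) ^ 2 + Cmod (C_derive h (w m z)) * Cmod (w q z)))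
      (abs_sum 2 a (Cmod (w p z))))
    (abs_sum 1 b (Cmod (w p z))).

(** [R2] is the unique root in (0,1) of 1 - x^(2m) - x^q = 0. *)
Definition is_R2 (m q : nat) (R2 : R) : Prop :=
  unique (fun x : R => 0 < x < 1 /\ 1 - x ^ (2 * m) - x ^ q = 0) R2.

Definition radius_fun (m p q : nat) (k x : R) : R :=
  - ((1 - x ^ (2 * m) - x ^ q) / (1 + x ^ m) ^ 2)
  + (x ^ p + k) * x ^ p / (1 - x ^ p).

(** The value of [radius_fun] at its pole x = 1 is irrelevant since r < 1. *)
Definition is_radius (m p q : nat) (k r : R) : Prop :=
  0 < r < 1 /\ radius_fun m p q k r = 0 /\
  forall s : R, 0 < s -> radius_fun m p q k s = 0 -> r <= s.

(* Main.v *)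
Require Import Defs.
From Stdlib Require Import Reals Ranalysis5 Lra Lia Psatz Wf_nat Classical ClassicalEpsilon.
From Coquelicot Require Import Coquelicot.
Open Scope R_scope.

(** Let [A = |a_0|], [rho = |w_m z|], [s = |w_q z|] and [t = |w_p z|], so that [rho <= r^m],
    [s <= r^q] and [t <= r^p] by the Schwarz lemma ([schwarz]). With [X = 1 - |h (w_m z)|^2],
    the Schwarz--Pick lemma gives [|h' (w_m z)| <= X / (1 - rho^2)]
    ([schwarz_pick_derive]) and [X >= (1 - A^2) (1 - rho^2) / (1 + A rho)^2]
    ([schwarz_pick_at_0]), while [|a_n| <= 1 - A^2] for [n >= 1] ([bounded_coeff_le]) bounds
    the sum over the [a_n] by [(1 - A^2) t^2 / (1 - t)]. Since [|g'| <= k |h'|], the square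
    sums of the [b_n] are at most [k^2] times those of the [a_n], whence
    [sum |b_n| t^n <= k (1 - A^2) t / (1 - t)] ([dilatation_coeff_sum]). Together, the Bohr sum
    is at most 1 as soon as
    [(1 - r^(2m) - r^q) / (1 + r^m)^2 >= (r^p + k) r^p / (1 - r^p)], which is the equation
    defining the radius ([bohr_real_inequality]).

    For sharpness take [h z = (x + z) / (1 + x z)], [g = k (h - x)] and [w_j z = z^j]. At
    [z = R] all the estimates above become equalities up to factors that tend to 1 with [x]:
    the Bohr sum is [1 + (1 - x^2) E x] ([moebius_bohr_sum]), where [E x] tends to the value of
    [radius_fun] at [R] as [x] tends to 1. That value is positive for [R > r], because
    [radius_fun] increases through its zero [r] ([radius_fun_incr]).

    The function theory rests on two facts. The maximum principle is proved for functions that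
    are locally quotients of analytic ones ([maximum_principle]), which makes it apply
    directly to [w z / z^j] and to the Schwarz--Pick quotient, removable singularities
    included. Parseval's formula is obtained by averaging [|F|^2] over the [N]-th roots of
    unity and letting [N] grow ([parseval]); it yields both coefficient estimates. *)

(** * Complex power series *)

Fixpoint csum (f : nat -> C) (n : nat) : C :=
  match n with O => RtoC 0 | S n => Cplus (csum f n) (f n) end.

Fixpoint rsum (f : nat -> R) (n : nat) : R :=
  match n with O => 0 | S n => rsum f n + f n end.

Definition sums (f : nat -> C) (l : C) : Prop :=
  forall eps, 0 < eps -> exists N0, forall N, (N0 <= N)%nat ->
    Cmod (Cminus (csum f N) l) < eps.

Lemma csum_sum_n f n : @sum_n C_AbelianMonoid f n = csum f (S n).
Proof.
induction n as [|n IH].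
- rewrite sum_O; symmetry; apply Cplus_0_l.
- rewrite sum_Sn, IH; reflexivity.
Qed.

Lemma rsum_sum_n f n : @sum_n R_AbelianMonoid f n = rsum f (S n).
Proof.
induction n as [|n IH].
- rewrite sum_O; symmetry; apply Rplus_0_l.
- rewrite sum_Sn, IH; reflexivity.
Qed.

Lemma is_series_sums f l :
  @is_series C_AbsRing C_NormedModule f l <-> sums f l.
Proof.
unfold is_series.
rewrite (filterlim_locally_ball_norm (K := C_AbsRing) (U := C_NormedModule)).
split.
- intros H eps Heps. destruct (H (mkposreal eps Heps)) as [N0 HN].
  exists (S N0); intros [|N] HN'; [lia|].
  specialize (HN N ltac:(lia)). rewrite <- csum_sum_n. exact HN.
- intros H eps. destruct (H eps (cond_pos eps)) as [N0 HN].
  exists N0; intros N HN'. specialize (HN (S N) ltac:(lia)).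
  rewrite <- csum_sum_n in HN. exact HN.
Qed.

Lemma Cmod_triangle_minus x y z : Cmod (Cminus x z) <= Cmod (Cminus x y) + Cmod (Cminus y z).
Proof.
replace (Cminus x z) with (Cplus (Cminus x y) (Cminus y z)) by ring.
apply Cmod_triangle.
Qed.

Lemma Cmod_minus_sym x y : Cmod (Cminus x y) = Cmod (Cminus y x).
Proof. rewrite <- Cmod_opp. f_equal; ring. Qed.

Lemma Cmod_triangle_rev x y : Cmod x - Cmod y <= Cmod (Cminus x y).
Proof.
generalize (Cmod_triangle (Cminus x y) y).
replace (Cplus (Cminus x y) y) with x by ring. lra.
Qed.

Lemma csum_ext f g n : (forall i, (i < n)%nat -> f i = g i) -> csum f n = csum g n.
Proof.
induction n as [|n IH]; intros H; simpl; [reflexivity|].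
rewrite IH by (intros; apply H; lia). rewrite H by lia. reflexivity.
Qed.

Lemma csum_zero f n : (forall i, (i < n)%nat -> f i = RtoC 0) -> csum f n = RtoC 0.
Proof.
induction n as [|n IH]; intros H; [reflexivity|]. cbn [csum].
rewrite IH, H by (intros; try apply H; lia). ring.
Qed.

Lemma csum_plus f g n :
  csum (fun i => Cplus (f i) (g i)) n = Cplus (csum f n) (csum g n).
Proof. induction n as [|n IH]; simpl; [ring | rewrite IH; ring]. Qed.

Lemma csum_scal a f n : csum (fun i => Cmult a (f i)) n = Cmult a (csum f n).
Proof. induction n as [|n IH]; simpl; [ring | rewrite IH; ring]. Qed.

Lemma csum_S_l f n : csum f (S n) = Cplus (f O) (csum (fun i => f (S i)) n).
Proof.
induction n as [|n IH]; [simpl; ring|].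
change (csum f (S (S n))) with (Cplus (csum f (S n)) (f (S n))).
rewrite IH. simpl. ring.
Qed.

Lemma Cmod_csum f n : Cmod (csum f n) <= rsum (fun i => Cmod (f i)) n.
Proof.
induction n as [|n IH]; simpl; [rewrite Cmod_0; lra|].
eapply Rle_trans; [apply Cmod_triangle|lra].
Qed.

Lemma rsum_le f g n : (forall i, (i < n)%nat -> f i <= g i) -> rsum f n <= rsum g n.
Proof.
induction n as [|n IH]; intros H; simpl; [lra|].
assert (rsum f n <= rsum g n) by (apply IH; intros; apply H; lia).
specialize (H n ltac:(lia)). lra.
Qed.

Lemma rsum_ext f g n : (forall i, (i < n)%nat -> f i = g i) -> rsum f n = rsum g n.
Proof.
intros H; apply Rle_antisym; apply rsum_le; intros i Hi; rewrite H by lia; lra.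
Qed.

Lemma rsum_scal a f n : rsum (fun i => a * f i) n = a * rsum f n.
Proof. induction n as [|n IH]; simpl; [ring | rewrite IH; ring]. Qed.

Lemma rsum_plus f g n : rsum (fun i => f i + g i) n = rsum f n + rsum g n.
Proof. induction n as [|n IH]; simpl; [ring | rewrite IH; ring]. Qed.

Lemma rsum_S_l f n : rsum f (S n) = f O + rsum (fun i => f (S i)) n.
Proof.
induction n as [|n IH]; [simpl; ring|].
change (rsum f (S (S n))) with (rsum f (S n) + f (S n)).
rewrite IH. simpl. ring.
Qed.

Lemma rsum_nonneg f n : (forall i, 0 <= f i) -> 0 <= rsum f n.
Proof. intros H; induction n as [|n IH]; simpl; [lra|specialize (H n); lra]. Qed.

Lemma rsum_mono f n m : (forall i, 0 <= f i) -> (n <= m)%nat -> rsum f n <= rsum f m.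
Proof. intros H Hm; induction Hm; simpl; [lra|specialize (H m); lra]. Qed.

Lemma rsum_le_Series f n :
  (forall i, 0 <= f i) -> ex_series f -> rsum f n <= Series f.
Proof.
intros Hpos Hex.
apply Rle_trans with (rsum f (S n)); [apply rsum_mono; auto|].
rewrite <- rsum_sum_n.
apply (is_lim_seq_incr_compare (sum_n f)).
- exact (Series_correct _ Hex).
- intros k. rewrite sum_Sn. specialize (Hpos (S k)). unfold plus; simpl; lra.
Qed.

Lemma is_lim_seq_rsum f l : is_series f l -> is_lim_seq (rsum f) l.
Proof.
intros H. apply is_lim_seq_incr_1.
apply is_lim_seq_ext with (sum_n f); [intros n; apply rsum_sum_n|exact H].
Qed.

Lemma sums_ext f g l : (forall i, f i = g i) -> sums f l -> sums g l.
Proof.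
intros H Hf eps He; destruct (Hf eps He) as [N0 HN]; exists N0; intros N HN'.
rewrite (csum_ext g f) by (intros; rewrite H; reflexivity). auto.
Qed.

Lemma sums_first f : (forall i, f (S i) = RtoC 0) -> sums f (f O).
Proof.
intros H eps He; exists 1%nat; intros [|N] HN; [lia|].
rewrite csum_S_l, csum_zero by (intros; apply H).
replace (Cminus _ _) with (RtoC 0) by ring. rewrite Cmod_0; exact He.
Qed.

Lemma sums_plus f g l m :
  sums f l -> sums g m -> sums (fun i => Cplus (f i) (g i)) (Cplus l m).
Proof.
intros Hf Hg; apply is_series_sums.
apply (is_series_plus (K := C_AbsRing) (V := C_NormedModule));
  apply is_series_sums; assumption.
Qed.

Lemma sums_scal a f l : sums f l -> sums (fun i => Cmult a (f i)) (Cmult a l).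
Proof.
intros Hf; apply is_series_sums.
apply (is_series_scal (K := C_AbsRing) (V := C_NormedModule) a f l).
apply is_series_sums; assumption.
Qed.

Lemma sums_S f l : sums (fun i => f (S i)) l -> sums f (Cplus (f O) l).
Proof.
intros H eps He; destruct (H eps He) as [N0 HN]; exists (S N0).
intros [|N] HN'; [lia|]. rewrite csum_S_l.
replace (Cminus _ _) with (Cminus (csum (fun i => f (S i)) N) l) by ring.
apply HN; lia.
Qed.

Lemma sums_unS f l : sums f l -> sums (fun i => f (S i)) (Cminus l (f O)).
Proof.
intros H eps He; destruct (H eps He) as [N0 HN]; exists N0.
intros N HN'. specialize (HN (S N) ltac:(lia)). rewrite csum_S_l in HN.
replace (Cminus _ _) with (Cminus (Cplus (f O) (csum (fun i => f (S i)) N)) l) by ring.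
exact HN.
Qed.

Lemma sums_Cmod_le f l B : sums f l -> (forall N, Cmod (csum f N) <= B) -> Cmod l <= B.
Proof.
intros H HB; apply le_epsilon; intros eps He.
destruct (H eps He) as [N HN]; specialize (HN N (le_n _)); specialize (HB N).
generalize (Cmod_triangle_rev l (csum f N)). rewrite Cmod_minus_sym. lra.
Qed.

Lemma sums_unique f l m : sums f l -> sums f m -> l = m.
Proof.
intros Hl Hm.
assert (H : Cmod (Cminus l m) <= 0).
{ apply le_epsilon; intros eps He.
  destruct (Hl (eps / 2)) as [N1 H1]; [lra|]; destruct (Hm (eps / 2)) as [N2 H2]; [lra|].
  specialize (H1 (N1 + N2)%nat ltac:(lia)); specialize (H2 (N1 + N2)%nat ltac:(lia)).
  generalize (Cmod_triangle_minus l (csum f (N1 + N2)) m).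
  rewrite (Cmod_minus_sym l (csum _ _)). lra. }
generalize (Cmod_ge_0 (Cminus l m)); intros.
assert (E : Cminus l m = 0) by (apply Cmod_eq_0; lra).
replace l with (Cplus (Cminus l m) m) by ring. rewrite E; ring.
Qed.

(** Expansions are centred at 0: an expansion of [F] at [z0] is one of
    [fun u => F (z0 + u)]. *)
Definition has_ps (c : nat -> C) (rho : R) (F : C -> C) : Prop :=
  forall u, Cmod u < rho -> sums (fun n => Cmult (c n) (Cpow u n)) (F u).

Lemma has_ps_expansion c rho F :
  has_ps c rho F <-> forall u, Cmod u < rho -> expansion 0 c u (F u).
Proof.
split; intros H u Hu; apply is_series_sums; apply H; assumption.
Qed.

Lemma has_ps_weaken c rho rho' F : rho' <= rho -> has_ps c rho F -> has_ps c rho' F.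
Proof. intros Hr H u Hu; apply H; lra. Qed.

Lemma has_ps_ext c rho F G :
  (forall u, Cmod u < rho -> F u = G u) -> has_ps c rho F -> has_ps c rho G.
Proof. intros E H u Hu; rewrite <- E by assumption; auto. Qed.

Lemma has_ps_0 c rho F : 0 < rho -> has_ps c rho F -> F (RtoC 0) = c O.
Proof.
intros Hr H. specialize (H (RtoC 0)). rewrite Cmod_0 in H. specialize (H Hr).
apply (sums_unique _ _ _ H).
replace (c O) with (Cmult (c O) (Cpow (RtoC 0) 0)) by (simpl; ring).
apply (sums_first (fun n => Cmult (c n) (Cpow (RtoC 0) n))). intros n; rewrite Cpow_S; ring.
Qed.

(** The terms of a convergent series are bounded, so by the Cauchy--Hadamard
    description of [CV_radius] the series of moduli converges in the same disc. *)
Lemma has_ps_radius c rho F s :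
  has_ps c rho F -> 0 <= s < rho -> Rbar_lt s (CV_radius (fun n => Cmod (c n))).
Proof.
intros H Hs. set (t := (s + rho) / 2).
apply Rbar_lt_le_trans with t; [unfold t; simpl; lra|].
apply (CV_radius_bounded (fun n => Cmod (c n))).
assert (Ht : Cmod (RtoC t) = t) by (rewrite Cmod_R, Rabs_pos_eq; unfold t; lra).
destruct (H (RtoC t) ltac:(rewrite Ht; unfold t; lra) 1 Rlt_0_1) as [N0 HN].
set (f := fun n => Cmult (c n) (Cpow (RtoC t) n)) in HN.
assert (Hf : forall n, (N0 <= n)%nat -> Cmod (f n) <= 2).
{ intros n Hn. pose proof (HN n Hn) as H1; pose proof (HN (S n) ltac:(lia)) as H2.
  simpl in H2. generalize (Cmod_triangle_minus (Cplus (csum f n) (f n)) (F (RtoC t)) (csum f n)).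
  rewrite (Cmod_minus_sym (F (RtoC t))).
  replace (Cminus (Cplus (csum f n) (f n)) (csum f n)) with (f n) by ring. lra. }
exists (rsum (fun n => Cmod (f n)) N0 + 2). intros n.
rewrite Rabs_pos_eq by (apply Rmult_le_pos; [apply Cmod_ge_0|apply pow_le; unfold t; lra]).
replace (Cmod (c n) * t ^ n) with (Cmod (f n))
  by (unfold f; rewrite Cmod_mult, Cmod_pow, Ht; reflexivity).
assert (P : forall i, 0 <= Cmod (f i)) by (intros; apply Cmod_ge_0).
destruct (Compare_dec.le_lt_dec N0 n) as [Hn|Hn].
- specialize (Hf n Hn). generalize (rsum_nonneg _ N0 P). lra.
- generalize (rsum_mono _ (S n) N0 P ltac:(lia)) (rsum_nonneg _ n P). simpl. lra.
Qed.

Lemma has_ps_abs c rho F s :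
  has_ps c rho F -> 0 <= s < rho -> ex_series (fun n => Cmod (c n) * s ^ n).
Proof.
intros H Hs. apply ex_series_ext with (fun n => Rabs (Cmod (c n) * s ^ n)).
- intros n; apply Rabs_pos_eq, Rmult_le_pos; [apply Cmod_ge_0|apply pow_le; lra].
- apply (CV_disk_inside (fun n => Cmod (c n)) s).
  rewrite Rabs_pos_eq by lra. apply (has_ps_radius c rho F); assumption.
Qed.

(** Comparison with the series of moduli at a larger radius [s] gives the geometric
    remainder estimate from which all local properties below are read off. *)
Lemma has_ps_tail c rho F s :
  has_ps c rho F -> 0 < s < rho ->
  exists S, 0 <= S /\ forall N u, Cmod u <= s ->
    Cmod (Cminus (F u) (csum (fun n => Cmult (c n) (Cpow u n)) N)) <= S * (Cmod u / s) ^ N.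
Proof.
intros H Hs. pose proof (has_ps_abs c rho F s H ltac:(lra)) as Hex.
assert (P : forall i, 0 <= Cmod (c i) * s ^ i)
  by (intros; apply Rmult_le_pos; [apply Cmod_ge_0|apply pow_le; lra]).
exists (Series (fun n => Cmod (c n) * s ^ n)); split.
{ exact (rsum_le_Series _ O P Hex). }
intros N u Hu. set (f := fun n => Cmult (c n) (Cpow u n)).
assert (Q : 0 <= Cmod u / s <= 1).
{ split; [apply Rdiv_le_0_compat; [apply Cmod_ge_0|lra]|apply Rle_div_l; lra]. }
assert (T : forall M, Cmod (csum (fun i => f (N + i)%nat) M) <=
   Series (fun n => Cmod (c n) * s ^ n) * (Cmod u / s) ^ N).
{ intros M. eapply Rle_trans; [apply Cmod_csum|].
  apply Rle_trans with ((Cmod u / s) ^ N * rsum (fun i => Cmod (c (N + i)%nat) * s ^ (N + i)) M).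
  - rewrite <- rsum_scal. apply rsum_le; intros i _. unfold f.
    rewrite Cmod_mult, Cmod_pow.
    replace (Cmod u ^ (N + i)) with ((Cmod u / s) ^ (N + i) * s ^ (N + i))
      by (rewrite <- Rpow_mult_distr; f_equal; field; lra).
    replace ((Cmod u / s) ^ (N + i)) with ((Cmod u / s) ^ N * (Cmod u / s) ^ i)
      by (rewrite pow_add; reflexivity).
    assert (0 <= (Cmod u / s) ^ i <= 1).
    { split; [apply pow_le; lra|rewrite <- (pow1 i); apply pow_incr; lra]. }
    assert (0 <= (Cmod u / s) ^ N) by (apply pow_le; lra).
    specialize (P (N + i)%nat).
    transitivity ((Cmod u / s) ^ N * (Cmod (c (N + i)%nat) * s ^ (N + i)) * (Cmod u / s) ^ i);
      [right; ring|].
    transitivity ((Cmod u / s) ^ N * (Cmod (c (N + i)%nat) * s ^ (N + i)) * 1); [|lra].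
    apply Rmult_le_compat_l; [apply Rmult_le_pos; assumption|lra].
  - rewrite Rmult_comm. apply Rmult_le_compat_r; [apply pow_le; lra|].
    apply Rle_trans with (rsum (fun n => Cmod (c n) * s ^ n) (N + M));
      [|apply rsum_le_Series; assumption].
    clear -P. revert P. set (g := fun n => Cmod (c n) * s ^ n). intros P.
    change (rsum (fun i => g (N + i)%nat) M <= rsum g (N + M)).
    induction M as [|M IH]; [simpl; rewrite Nat.add_0_r; apply rsum_nonneg, P|].
    rewrite Nat.add_succ_r. simpl. lra. }
revert T. generalize (Series (fun n => Cmod (c n) * s ^ n) * (Cmod u / s) ^ N).
intros B T. apply (sums_Cmod_le (fun i => f (N + i)%nat)); [|exact T].
assert (Hf : sums f (F u)) by (apply H; lra).
clear -Hf. induction N as [|N IH].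
- simpl. replace (Cminus (F u) 0) with (F u) by ring. exact Hf.
- apply sums_unS in IH. simpl.
  apply sums_ext with (fun i => f (N + S i)%nat);
    [intros i; f_equal; lia|].
  replace (Cminus (F u) (Cplus (csum f N) (f N)))
    with (Cminus (Cminus (F u) (csum f N)) (f (N + 0)%nat))
    by (rewrite Nat.add_0_r; ring).
  exact IH.
Qed.

(** * Operations on power series *)

Lemma has_ps_lin a b c d rho F G :
  has_ps c rho F -> has_ps d rho G ->
  has_ps (fun n => Cplus (Cmult a (c n)) (Cmult b (d n))) rho
    (fun u => Cplus (Cmult a (F u)) (Cmult b (G u))).
Proof.
intros HF HG u Hu.
apply sums_ext with (fun n => Cplus (Cmult a (Cmult (c n) (Cpow u n)))
                                    (Cmult b (Cmult (d n) (Cpow u n))));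
  [intros n; ring|].
apply sums_plus; apply sums_scal; auto.
Qed.

Definition coeff_shift (c : nat -> C) (n : nat) : C :=
  match n with O => RtoC 0 | S n => c n end.

Lemma has_ps_mul_id c rho F :
  has_ps c rho F -> has_ps (coeff_shift c) rho (fun u => Cmult u (F u)).
Proof.
intros H u Hu.
replace (Cmult u (F u)) with
  (Cplus (Cmult (coeff_shift c 0) (Cpow u 0)) (Cmult u (F u))) by (simpl; ring).
apply (sums_S (fun n => Cmult (coeff_shift c n) (Cpow u n))).
apply sums_ext with (fun n => Cmult u (Cmult (c n) (Cpow u n)));
  [intros n; rewrite Cpow_S; simpl; ring|].
apply sums_scal; auto.
Qed.

Lemma has_ps_div_id c rho F G :
  0 < rho -> has_ps c rho F -> c O = RtoC 0 ->
  (forall u, Cmod u < rho -> u <> RtoC 0 -> F u = Cmult u (G u)) -> G (RtoC 0) = c 1%nat ->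
  has_ps (fun n => c (S n)) rho G.
Proof.
intros Hr H H0 HG HG0 u Hu.
destruct (classic (u = RtoC 0)) as [->|Hu0].
- rewrite HG0. replace (c 1%nat) with (Cmult (c 1%nat) (Cpow (RtoC 0) 0)) by (simpl; ring).
  apply (sums_first (fun n => Cmult (c (S n)) (Cpow (RtoC 0) n))). intros n; rewrite Cpow_S; ring.
- specialize (H u Hu). apply sums_unS in H. rewrite H0, (HG u Hu Hu0) in H.
  apply (sums_scal (Cinv u)) in H.
  replace (G u) with (Cmult (Cinv u) (Cminus (Cmult u (G u)) (Cmult 0 (Cpow u 0))))
    by (simpl; field; exact Hu0).
  eapply sums_ext; [|exact H]. intros n; cbv beta; rewrite Cpow_S; field; exact Hu0.
Qed.

Definition coeff_const (a : C) (n : nat) : C :=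
  match n with O => a | S _ => RtoC 0 end.

Lemma has_ps_const a rho : has_ps (coeff_const a) rho (fun _ => a).
Proof.
intros u _.
pose proof (sums_first (fun n => Cmult (coeff_const a n) (Cpow u n))) as H.
cbn [coeff_const Cpow] in H. rewrite Cmult_1_r in H. apply H. intros n; ring.
Qed.

Lemma has_ps_affine_mul a b c rho F :
  has_ps c rho F ->
  has_ps (fun n => Cplus (Cmult a (c n)) (Cmult b (coeff_shift c n))) rho
    (fun u => Cmult (Cplus a (Cmult b u)) (F u)).
Proof.
intros H.
apply has_ps_ext with (fun u => Cplus (Cmult a (F u)) (Cmult b (Cmult u (F u))));
  [intros u _; ring|].
apply has_ps_lin; [|apply has_ps_mul_id]; assumption.
Qed.

Lemma geom_eventually_lt q A : 0 <= q < 1 ->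
  forall eps, 0 < eps -> exists N0, forall N, (N0 <= N)%nat -> A * q ^ N < eps.
Proof.
intros Hq eps He.
assert (H : is_lim_seq (fun n => A * q ^ n) (A * 0)).
{ apply (is_lim_seq_scal_l _ A 0). apply is_lim_seq_geom. rewrite Rabs_pos_eq; lra. }
rewrite Rmult_0_r in H. apply is_lim_seq_spec in H.
destruct (H (mkposreal eps He)) as [N0 HN]. exists N0; intros N HN'.
specialize (HN N HN'); simpl in HN. apply Rabs_def2 in HN. lra.
Qed.

(** The geometric series; it expands the extremal mappings around every point. *)
Lemma has_ps_geom p q rho :
  p <> RtoC 0 -> 0 < rho -> Cmod q * rho <= Cmod p ->
  has_ps (fun n => Cdiv (Cpow (Copp (Cdiv q p)) n) p) rho
    (fun u => Cinv (Cplus p (Cmult q u))).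
Proof.
intros Hp Hr Hq u Hu.
assert (Hp' : 0 < Cmod p) by (apply Cmod_gt_0; exact Hp).
set (w := Cmult (Copp (Cdiv q p)) u).
assert (Hw : 0 <= Cmod w < 1).
{ split; [apply Cmod_ge_0|]. unfold w. rewrite Cmod_mult, Cmod_opp, Cmod_div by exact Hp.
  replace (Cmod q / Cmod p * Cmod u) with (Cmod q * Cmod u / Cmod p) by (field; lra).
  apply Rlt_div_l; [lra|]. rewrite Rmult_1_l.
  destruct (Req_dec (Cmod q) 0) as [->|]; [lra|].
  assert (0 < Cmod q) by (generalize (Cmod_ge_0 q); lra).
  apply Rlt_le_trans with (Cmod q * rho); [apply Rmult_lt_compat_l|]; lra. }
assert (H1 : Cminus (RtoC 1) w <> RtoC 0).
{ intros E. assert (w = RtoC 1) as -> by (replace w with (Cminus (RtoC 1) (Cminus (RtoC 1) w)) by ring; rewrite E; ring).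
  rewrite Cmod_1 in Hw; lra. }
assert (Hd : Cplus p (Cmult q u) = Cmult p (Cminus (RtoC 1) w))
  by (unfold w; field; exact Hp).
apply sums_ext with (fun n => Cmult (Cinv p) (Cpow w n)).
{ intros n; unfold w; rewrite Cpow_mult_l; field; exact Hp. }
replace (Cinv (Cplus p (Cmult q u))) with (Cmult (Cinv p) (Cinv (Cminus (RtoC 1) w)))
  by (rewrite Hd; field; split; assumption).
apply sums_scal.
assert (HS : forall N, csum (fun n => Cpow w n) N =
   Cmult (Cminus (RtoC 1) (Cpow w N)) (Cinv (Cminus (RtoC 1) w))).
{ induction N as [|N IH]; [simpl; field; exact H1|].
  cbn [csum]; rewrite IH, Cpow_S; field; exact H1. }
intros eps He.
destruct (geom_eventually_lt (Cmod w) (Cmod (Cinv (Cminus (RtoC 1) w))) Hw eps He) as [N0 HN].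
exists N0; intros N HN'. rewrite HS.
replace (Cminus _ _) with (Copp (Cmult (Cinv (Cminus (RtoC 1) w)) (Cpow w N))) by (field; exact H1).
rewrite Cmod_opp, Cmod_mult, Cmod_pow. apply HN; exact HN'.
Qed.

(** Every derivative below is read off a Taylor estimate, whose remainder is quadratic. *)
Lemma C_derive_quadratic F z0 l K d :
  0 < d -> (forall v, Cmod v < d ->
     Cmod (Cminus (Cminus (F (Cplus z0 v)) (F z0)) (Cmult l v)) <= K * Cmod v ^ 2) ->
  C_derive F z0 = l.
Proof.
intros Hd H. apply is_C_derive_unique. split.
- apply is_linear_scal_l.
- intros x Hx. 
  apply (is_filter_lim_locally_unique (K := C_AbsRing) (V := AbsRing_NormedModule C_AbsRing) z0 x) in Hx.
  subst x. intros eps.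
  assert (Hd' : 0 < Rmin d (eps / (Rabs K + 1))).
  { apply Rmin_pos; [exact Hd|]. apply Rdiv_lt_0_compat; [apply cond_pos|].
    generalize (Rabs_pos K); lra. }
  exists (mkposreal _ Hd'). intros y; change C in y; intros Hy.
  change (Cmod (Cminus y z0) < Rmin d (eps / (Rabs K + 1))) in Hy.
  change (Cmod (Cminus (Cminus (F y) (F z0)) (Cmult (Cminus y z0) l)) <= eps * Cmod (Cminus y z0)).
  set (v := Cminus y z0) in *.
  assert (H1 : Cmod v < d) by (eapply Rlt_le_trans; [exact Hy|apply Rmin_l]).
  assert (H2 : Cmod v < eps / (Rabs K + 1)) by (eapply Rlt_le_trans; [exact Hy|apply Rmin_r]).
  specialize (H v H1). replace (Cplus z0 v) with y in H by (unfold v; ring).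
  replace (Cmult v l) with (Cmult l v) by ring.
  eapply Rle_trans; [exact H|].
  generalize (Cmod_ge_0 v) (Rabs_pos K) (Rle_abs K); intros.
  apply Rlt_div_r in H2; [|lra].
  apply Rle_trans with ((Cmod v * (Rabs K + 1)) * Cmod v); nra.
Qed.

Lemma C_derive_ps c rho F z0 :
  0 < rho -> has_ps c rho (fun u => F (Cplus z0 u)) -> C_derive F z0 = c 1%nat.
Proof.
intros Hr H. destruct (has_ps_tail c rho _ (rho / 2) H ltac:(lra)) as (S & HS & HT).
apply C_derive_quadratic with (S / (rho / 2) ^ 2) (rho / 2); [lra|].
intros v Hv. specialize (HT 2%nat v ltac:(lra)).
replace (F z0) with (c O) by
  (rewrite <- (has_ps_0 c rho _ Hr H); f_equal; ring).
replace (Cminus (Cminus (F (Cplus z0 v)) (c O)) (Cmult (c 1%nat) v)) with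
  (Cminus (F (Cplus z0 v)) (csum (fun n => Cmult (c n) (Cpow v n)) 2)) by (simpl; ring).
eapply Rle_trans; [exact HT|]. right. field. lra.
Qed.

Lemma Cpow_taylor_2 s x y : 0 <= s -> Cmod x <= s -> Cmod y <= s -> forall k,
  Cmod (Cminus (Cminus (Cpow x (S (S k))) (Cpow y (S (S k))))
     (Cmult (Cmult (RtoC (INR (S (S k)))) (Cpow y (S k))) (Cminus x y)))
  <= INR (S (S k)) * INR (S k) * s ^ k * Cmod (Cminus x y) ^ 2.
Proof.
intros Hs Hx Hy. induction k as [|k IH].
- replace (Cminus _ _) with (Cpow (Cminus x y) 2)
    by (replace (INR 2) with (1 + 1) by (simpl; ring); rewrite RtoC_plus; simpl; ring).
  rewrite Cmod_pow. generalize (pow2_ge_0 (Cmod (Cminus x y))).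
  replace (INR 2 * INR 1 * s ^ 0) with 2 by (simpl; ring). lra.
- set (e := Cminus (Cminus _ _) _) in IH.
  replace (Cminus _ _) with
    (Cplus (Cmult x e) (Cmult (Cmult (RtoC (INR (S (S k)))) (Cpow y (S k))) (Cpow (Cminus x y) 2))).
  2:{ unfold e. rewrite (S_INR (S (S k))), RtoC_plus. simpl Cpow. ring. }
  eapply Rle_trans; [apply Cmod_triangle|].
  rewrite !Cmod_mult, !Cmod_pow, Cmod_R, Rabs_pos_eq by apply pos_INR.
  set (D := Cmod (Cminus x y) ^ 2) in *.
  assert (HD : 0 <= D) by apply pow2_ge_0.
  assert (Hy' : Cmod y ^ S k <= s ^ S k) by (apply pow_incr; split; [apply Cmod_ge_0|assumption]).
  assert (H1 : Cmod x * Cmod e <= s * (INR (S (S k)) * INR (S k) * s ^ k * D)).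
  { apply Rmult_le_compat; auto using Cmod_ge_0. }
  assert (H2 : INR (S (S k)) * Cmod y ^ S k * D <= INR (S (S k)) * s ^ S k * D).
  { apply Rmult_le_compat_r; [exact HD|]. apply Rmult_le_compat_l; [apply pos_INR|exact Hy']. }
  eapply Rle_trans; [apply Rplus_le_compat; [exact H1|exact H2]|].
  rewrite (S_INR (S (S k))), (S_INR (S k)), (S_INR k).
  generalize (pos_INR k); intros Hk.
  assert (0 <= s ^ S k * D * (INR k + 2)).
  { apply Rmult_le_pos; [apply Rmult_le_pos; [apply pow_le|]; assumption|lra]. }
  simpl (s ^ S k) in *. nra.
Qed.

Definition coeff_derive (c : nat -> C) (n : nat) : C :=
  Cmult (RtoC (INR (S n))) (c (S n)).

(** The series of moduli may be differentiated twice within its disc; its second derivative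
    at a slightly larger radius bounds all second-order Taylor remainders at once. *)
Lemma has_ps_derive c rho F :
  has_ps c rho F -> has_ps (coeff_derive c) rho (C_derive F).
Proof.
intros H u Hu. set (s := (Cmod u + rho) / 2).
generalize (Cmod_ge_0 u); intros Hu0.
assert (Hs : Cmod u < s < rho) by (unfold s; lra).
set (A := fun n => Cmod (c n)).
assert (HA : Rbar_lt (Rabs s) (CV_radius A)).
{ rewrite Rabs_pos_eq by lra. apply (has_ps_radius c rho F s H); lra. }
assert (E1 : ex_series (fun n => INR (S n) * Cmod (c (S n)) * s ^ n)).
{ eapply ex_series_ext; [|apply (CV_disk_inside (PS_derive A) s)].
  - intros n. apply Rabs_pos_eq. apply Rmult_le_pos; [|apply pow_le; lra].
    apply Rmult_le_pos; [apply pos_INR|apply Cmod_ge_0].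
  - rewrite CV_radius_derive; exact HA. }
assert (E2 : ex_series (fun n => INR (S n) * (INR (S (S n)) * Cmod (c (S (S n)))) * s ^ n)).
{ eapply ex_series_ext; [|apply (CV_disk_inside (PS_derive (PS_derive A)) s)].
  - intros n. apply Rabs_pos_eq. apply Rmult_le_pos; [|apply pow_le; lra].
    apply Rmult_le_pos; [apply pos_INR|]. apply Rmult_le_pos; [apply pos_INR|apply Cmod_ge_0].
  - rewrite !CV_radius_derive; exact HA. }
assert (EG : exists l, sums (fun n => Cmult (coeff_derive c n) (Cpow u n)) l).
{ destruct (ex_series_le (K := C_AbsRing) (V := C_CompleteNormedModule)
     (fun n => Cmult (coeff_derive c n) (Cpow u n))
     (fun n => INR (S n) * Cmod (c (S n)) * s ^ n)) as [l Hl]; [|exact E1|].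
  - intros n. change (Cmod (Cmult (coeff_derive c n) (Cpow u n)) <= INR (S n) * Cmod (c (S n)) * s ^ n).
    unfold coeff_derive. rewrite !Cmod_mult, Cmod_pow, Cmod_R, Rabs_pos_eq by apply pos_INR.
    apply Rmult_le_compat_l; [apply Rmult_le_pos; [apply pos_INR|apply Cmod_ge_0]|].
    apply pow_incr; lra.
  - exists l. apply is_series_sums. exact Hl. }
destruct EG as [l Hl].
replace (C_derive F u) with l; [exact Hl|symmetry].
set (K := Series (fun n => INR (S n) * (INR (S (S n)) * Cmod (c (S (S n)))) * s ^ n)).
apply C_derive_quadratic with K (s - Cmod u); [lra|].
intros v Hv.
assert (Huv : Cmod (Cplus u v) <= s) by (generalize (Cmod_triangle u v); lra).
pose proof (H (Cplus u v) ltac:(lra)) as S1; pose proof (H u ltac:(lra)) as S2.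
apply sums_unS, sums_unS in S1; apply sums_unS, sums_unS in S2.
pose proof (sums_unS _ _ Hl) as S3.
apply (sums_scal (RtoC (-1))) in S2. apply (sums_scal (Copp v)) in S3.
pose proof (sums_plus _ _ _ _ (sums_plus _ _ _ _ S1 S2) S3) as S4. cbv beta in S4.
match type of S4 with sums _ ?x =>
  replace (Cminus (Cminus (F (Cplus u v)) (F u)) (Cmult l v)) with x end.
2:{ unfold coeff_derive. replace (INR 1) with 1 by reflexivity. simpl.
    replace (RtoC (-1)) with (Copp (RtoC 1)) by (rewrite <- RtoC_opp; f_equal). ring. }
apply (sums_Cmod_le _ _ _ S4). intros N.
eapply Rle_trans; [apply Cmod_csum|].
apply Rle_trans with
  (Cmod v ^ 2 * rsum (fun n => INR (S n) * (INR (S (S n)) * Cmod (c (S (S n)))) * s ^ n) N).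
- rewrite <- rsum_scal. apply rsum_le; intros k _.
  generalize (Cpow_taylor_2 s (Cplus u v) u ltac:(lra) Huv ltac:(lra) k).
  replace (Cminus (Cplus u v) u) with v by ring. intros HT.
  apply (Rmult_le_compat_l (Cmod (c (S (S k))))) in HT; [|apply Cmod_ge_0].
  rewrite <- Cmod_mult in HT.
  eapply Rle_trans; [|eapply Rle_trans; [exact HT|right; ring]].
  right; f_equal. unfold coeff_derive.
  replace (RtoC (-1)) with (Copp (RtoC 1)) by (rewrite <- RtoC_opp; f_equal). ring.
- rewrite Rmult_comm. apply Rmult_le_compat_r; [apply pow2_ge_0|].
  apply rsum_le_Series; [|exact E2]. intros i.
  apply Rmult_le_pos; [|apply pow_le; lra].
  apply Rmult_le_pos; [apply pos_INR|]. apply Rmult_le_pos; [apply pos_INR|apply Cmod_ge_0].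
Qed.

Lemma C_derive_n_ps rho F : 0 < rho -> forall i c, has_ps c rho F ->
  exists c', has_ps c' rho (C_derive_n i F) /\ C_derive_n i F (RtoC 0) = c' O /\
    forall n, c' n = Cmult (RtoC (INR (Factorial.fact (i + n)) / INR (Factorial.fact n))) (c (i + n)%nat).
Proof.
intros Hr i c H. induction i as [|i (c' & H' & _ & E)].
- exists c. split; [exact H|]. split; [exact (has_ps_0 c rho F Hr H)|].
  intros n; simpl. replace (INR (Factorial.fact n) / INR (Factorial.fact n)) with 1 by (field; apply INR_fact_neq_0). ring.
- exists (coeff_derive c').
  assert (H1 : has_ps (coeff_derive c') rho (C_derive_n (S i) F)) by exact (has_ps_derive _ _ _ H').
  split; [exact H1|]. split; [exact (has_ps_0 _ _ _ Hr H1)|].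
  intros n. unfold coeff_derive. rewrite E, Cmult_assoc, <- RtoC_mult.
  replace (i + S n)%nat with (S i + n)%nat by lia. f_equal. f_equal.
  change (Factorial.fact (S n)) with (S n * Factorial.fact n)%nat. rewrite mult_INR. field.
  split; [apply INR_fact_neq_0|apply not_0_INR; lia].
Qed.

(** Hence the vanishing of the first [j] derivatives at 0 removes the first [j] coefficients. *)
Lemma C_derive_n_0 c rho F i : 0 < rho -> has_ps c rho F ->
  C_derive_n i F (RtoC 0) = Cmult (RtoC (INR (Factorial.fact i))) (c i).
Proof.
intros Hr H. destruct (C_derive_n_ps rho F Hr i c H) as (c' & _ & -> & ->).
rewrite Nat.add_0_r. simpl. f_equal. f_equal. field.
Qed.

(** * Points of the unit circle *)

Definition cis (t : R) : C := (cos t, sin t).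

Lemma Cmod_cis t : Cmod (cis t) = 1.
Proof.
unfold Cmod, cis; simpl. rewrite <- sqrt_1 at 3. f_equal.
generalize (sin2_cos2 t). unfold Rsqr. lra.
Qed.

Lemma cis_plus s t : cis (s + t) = Cmult (cis s) (cis t).
Proof.
unfold cis, Cmult; simpl. rewrite cos_plus, sin_plus. f_equal; ring.
Qed.

Lemma cis_pow t n : Cpow (cis t) n = cis (INR n * t).
Proof.
induction n as [|n IH].
- simpl. unfold cis. rewrite Rmult_0_l, cos_0, sin_0. reflexivity.
- rewrite Cpow_S, IH, <- cis_plus, S_INR. f_equal; ring.
Qed.

Lemma cis_surj v : Cmod v = 1 -> exists t, v = cis t.
Proof.
intros Hv. destruct v as [x y].
assert (Hxy : x * x + y * y = 1).
{ generalize (Cmod2_alt (x, y)); rewrite Hv; simpl; lra. }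
assert (Hx : -1 <= x <= 1) by nra.
destruct (Rle_or_lt 0 y) as [Hy|Hy].
- exists (acos x). unfold cis. rewrite cos_acos, sin_acos by exact Hx. f_equal.
  symmetry; apply sqrt_lem_1; unfold Rsqr; nra.
- exists (- acos x). unfold cis. rewrite cos_neg, sin_neg, cos_acos, sin_acos by exact Hx. f_equal.
  replace y with (- - y) by ring. f_equal.
  symmetry; apply sqrt_lem_1; unfold Rsqr; nra.
Qed.

Lemma unit_root v n : Cmod v = 1 -> (1 <= n)%nat -> exists w, Cmod w = 1 /\ Cpow w n = v.
Proof.
intros Hv Hn. destruct (cis_surj v Hv) as [t ->].
exists (cis (t / INR n)). split; [apply Cmod_cis|].
rewrite cis_pow. f_equal. field. apply not_0_INR; lia.
Qed.

Lemma polar c : exists v, Cmod v = 1 /\ c = Cmult (RtoC (Cmod c)) v.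
Proof.
destruct (classic (c = RtoC 0)) as [->|Hc].
- exists (RtoC 1). rewrite Cmod_0, Cmod_1. split; [reflexivity|ring].
- assert (Hc' : 0 < Cmod c) by (apply Cmod_gt_0; exact Hc).
  assert (Hn : RtoC (Cmod c) <> RtoC 0) by (intros E; injection E; lra).
  exists (Cdiv c (RtoC (Cmod c))). split.
  + rewrite Cmod_div by exact Hn. rewrite Cmod_R, Rabs_pos_eq by lra. field; lra.
  + field; exact Hn.
Qed.

(** * Analyticity at a point *)

Definition analytic_at (F : C -> C) (z0 : C) : Prop :=
  exists c rho, 0 < rho /\ has_ps c rho (fun u => F (Cplus z0 u)).

Lemma analytic_on_disc_at F :
  analytic_on_disc F <-> forall z, Cmod z < 1 -> analytic_at F z.
Proof.
split; intros H z Hz; destruct (H z Hz) as (c & rho & Hr & HE); exists c, rho;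
  (split; [exact Hr|]).
- intros u Hu. apply is_series_sums.
  specialize (HE (Cplus z u)). replace (Cminus (Cplus z u) z) with u in HE by ring.
  exact (HE Hu).
- intros w Hw. apply is_series_sums. specialize (HE (Cminus w z) Hw).
  cbv beta in HE. replace (Cplus z (Cminus w z)) with w in HE by ring. exact HE.
Qed.

Lemma analytic_at_ext F G z :
  (forall w, F w = G w) -> analytic_at F z -> analytic_at G z.
Proof.
intros E (c & rho & Hr & H); exists c, rho; split; [exact Hr|].
apply has_ps_ext with (2 := H); intros u _; apply E.
Qed.

Lemma analytic_at_lin a b F G z :
  analytic_at F z -> analytic_at G z ->
  analytic_at (fun w => Cplus (Cmult a (F w)) (Cmult b (G w))) z.
Proof.
intros (c & rho & Hr & H) (d & rho' & Hr' & H').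
exists (fun n => Cplus (Cmult a (c n)) (Cmult b (d n))), (Rmin rho rho').
split; [apply Rmin_pos; assumption|].
apply (has_ps_lin a b c d _ (fun u => F (Cplus z u)) (fun u => G (Cplus z u)));
  eapply has_ps_weaken; try eassumption; [apply Rmin_l|apply Rmin_r].
Qed.

Lemma analytic_at_const a z : analytic_at (fun _ => a) z.
Proof. exists (coeff_const a), 1; split; [lra|apply has_ps_const]. Qed.

Lemma analytic_at_affine_mul a b F z :
  analytic_at F z -> analytic_at (fun w => Cmult (Cplus a (Cmult b w)) (F w)) z.
Proof.
intros (c & rho & Hr & H). eexists; exists rho; split; [exact Hr|].
eapply has_ps_ext; [|exact (has_ps_affine_mul (Cplus a (Cmult b z)) b _ _ _ H)].
intros u _; cbv beta; ring.
Qed.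

Lemma analytic_at_pow n z : analytic_at (fun w => Cpow w n) z.
Proof.
induction n as [|n IH]; [exact (analytic_at_const 1 z)|].
apply analytic_at_ext with (fun w => Cmult (Cplus 0 (Cmult 1 w)) (Cpow w n)).
- intros w; rewrite Cpow_S; ring.
- apply analytic_at_affine_mul, IH.
Qed.

(** An identically vanishing expansion or a first nonzero coefficient: away from the
    constant case an analytic quotient behaves like [F z0 + e u^n]. *)
Lemma quotient_leading_term P Q F z0 d :
  analytic_at P z0 -> analytic_at Q z0 -> Q z0 <> RtoC 0 -> 0 < d ->
  (forall u, Cmod u < d -> Cmult (F (Cplus z0 u)) (Q (Cplus z0 u)) = P (Cplus z0 u)) ->
  (exists r, 0 < r /\ forall u, Cmod u < r -> F (Cplus z0 u) = F z0) \/
  (exists n e K r, (1 <= n)%nat /\ e <> RtoC 0 /\ 0 < r /\ forall u, Cmod u < r ->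
     Cmod (Cminus (F (Cplus z0 u)) (Cplus (F z0) (Cmult e (Cpow u n)))) <= K * Cmod u ^ (S n)).
Proof.
intros (p & rp & Hrp & HP) (q & rq & Hrq & HQ) HQ0 Hd HF.
set (rho := Rmin rp rq).
assert (Hrho : 0 < rho) by (apply Rmin_pos; assumption).
set (c := F z0).
assert (HD : has_ps (fun n => Cplus (Cmult 1 (p n)) (Cmult (Copp c) (q n))) rho
    (fun u => Cplus (Cmult 1 (P (Cplus z0 u))) (Cmult (Copp c) (Q (Cplus z0 u))))).
{ apply (has_ps_lin 1 (Copp c) p q _ (fun u => P (Cplus z0 u)) (fun u => Q (Cplus z0 u)));
  eapply has_ps_weaken; try eassumption; [apply Rmin_l|apply Rmin_r]. }
set (dc := fun n => Cplus (Cmult 1 (p n)) (Cmult (Copp c) (q n))) in HD.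
set (D := fun u => Cplus (Cmult 1 (P (Cplus z0 u))) (Cmult (Copp c) (Q (Cplus z0 u)))) in HD.
assert (Hz0 : Cplus z0 (RtoC 0) = z0) by ring.
assert (Hq0 : q O = Q z0).
{ rewrite <- (has_ps_0 _ _ _ Hrq HQ), Hz0; reflexivity. }
assert (HD0 : dc O = RtoC 0).
{ rewrite <- (has_ps_0 _ _ _ Hrho HD). unfold D. rewrite Hz0.
  specialize (HF (RtoC 0)). rewrite Cmod_0, Hz0 in HF. rewrite <- HF by lra. unfold c; ring. }
(* near z0, Q stays away from 0 and is Lipschitz at z0 *)
destruct (has_ps_tail q rq _ (rq / 2) HQ ltac:(lra)) as (Sq & HSq & TQ).
set (L := Sq / (rq / 2)).
assert (HL : 0 <= L) by (apply Rdiv_le_0_compat; lra).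
assert (LQ : forall u, Cmod u <= rq / 2 -> Cmod (Cminus (Q (Cplus z0 u)) (Q z0)) <= L * Cmod u).
{ intros u Hu. specialize (TQ 1%nat u Hu). simpl in TQ.
  rewrite Hq0 in TQ. replace (Cplus (RtoC 0) (Cmult (Q z0) (RtoC 1))) with (Q z0) in TQ by ring.
  eapply Rle_trans; [exact TQ|]. unfold L; right; field; lra. }
set (m := Cmod (Q z0)). assert (Hm : 0 < m) by (apply Cmod_gt_0; exact HQ0).
set (r0 := Rmin (Rmin d rho) (Rmin (rq / 2) (m / (2 * (L + 1))))).
assert (Hr0 : 0 < r0).
{ repeat apply Rmin_pos; try lra. apply Rdiv_lt_0_compat; lra. }
assert (Hr0' : forall u, Cmod u < r0 -> Cmod u < d /\ Cmod u < rho /\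
    m / 2 <= Cmod (Q (Cplus z0 u)) /\ Cmod (Cminus (Q (Cplus z0 u)) (Q z0)) <= L * Cmod u).
{ intros u Hu.
  assert (A1 : Cmod u < Rmin d rho) by (eapply Rlt_le_trans; [exact Hu|apply Rmin_l]).
  assert (A2 : Cmod u < Rmin (rq / 2) (m / (2 * (L + 1)))) by (eapply Rlt_le_trans; [exact Hu|apply Rmin_r]).
  assert (A3 : Cmod u < rq / 2) by (eapply Rlt_le_trans; [exact A2|apply Rmin_l]).
  assert (A4 : Cmod u < m / (2 * (L + 1))) by (eapply Rlt_le_trans; [exact A2|apply Rmin_r]).
  split; [eapply Rlt_le_trans; [exact A1|apply Rmin_l]|].
  split; [eapply Rlt_le_trans; [exact A1|apply Rmin_r]|].
  specialize (LQ u ltac:(lra)). split; [|exact LQ].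
  generalize (Cmod_triangle_rev (Q z0) (Q (Cplus z0 u))). rewrite Cmod_minus_sym. fold m.
  apply Rlt_div_r in A4; [|lra]. generalize (Cmod_ge_0 u); nra. }
assert (HFD : forall u, Cmod u < r0 ->
    Cmult (Cminus (F (Cplus z0 u)) c) (Q (Cplus z0 u)) = D u).
{ intros u Hu. unfold D. rewrite <- HF by (apply Hr0'; exact Hu). ring. }
assert (HQn : forall u, Cmod u < r0 -> Q (Cplus z0 u) <> RtoC 0).
{ intros u Hu E. destruct (Hr0' u Hu) as (_ & _ & B & _). rewrite E, Cmod_0 in B. lra. }
destruct (classic (exists n, dc n <> RtoC 0)) as [Hex|Hno].
- right.
  destruct (dec_inh_nat_subset_has_unique_least_element (fun n => dc n <> RtoC 0)
    (fun n => classic _) Hex) as (n & (Hn & Hmin) & _).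
  assert (Hlow : forall i, (i < n)%nat -> dc i = RtoC 0).
  { intros i Hi. apply NNPP; intros Hc. specialize (Hmin i Hc). lia. }
  destruct (has_ps_tail dc rho D (rho / 2) HD ltac:(lra)) as (Sd & HSd & TD).
  set (e := Cdiv (dc n) (Q z0)).
  set (K1 := Sd / (rho / 2) ^ (S n)).
  exists n, e, (2 / m * (K1 + Cmod e * L)), (Rmin r0 (rho / 2)).
  split; [destruct n; [congruence|lia]|].
  split.
  { unfold e; intros E. apply Hn.
    replace (dc n) with (Cmult (Cdiv (dc n) (Q z0)) (Q z0)) by (field; exact HQ0).
    rewrite E; ring. }
  split; [apply Rmin_pos; lra|].
  intros u Hu.
  assert (Hu1 : Cmod u < r0) by (eapply Rlt_le_trans; [exact Hu|apply Rmin_l]).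
  assert (Hu2 : Cmod u < rho / 2) by (eapply Rlt_le_trans; [exact Hu|apply Rmin_r]).
  assert (HT : Cmod (Cminus (D u) (Cmult (dc n) (Cpow u n))) <= K1 * Cmod u ^ S n).
  { specialize (TD (S n) u ltac:(lra)). cbn [csum] in TD.
    replace (csum (fun i => Cmult (dc i) (Cpow u i)) n) with (RtoC 0) in TD.
    - replace (Cplus (RtoC 0) (Cmult (dc n) (Cpow u n))) with (Cmult (dc n) (Cpow u n)) in TD by ring.
      eapply Rle_trans; [exact TD|]. right. unfold K1, Rdiv.
      rewrite Rpow_mult_distr, pow_inv. ring.
    - clear -Hlow. induction n as [|n IH]; [reflexivity|]. cbn [csum].
      rewrite <- IH by (intros; apply Hlow; lia). rewrite Hlow by lia. ring. }
  destruct (Hr0' u Hu1) as (_ & _ & HQb & HQl).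
  specialize (HFD u Hu1). specialize (HQn u Hu1).
  set (Qu := Q (Cplus z0 u)) in *. set (w := Cminus _ _).
  assert (Ew : Cmult w Qu = Cminus (Cminus (D u) (Cmult (dc n) (Cpow u n)))
      (Cmult (Cmult e (Cminus Qu (Q z0))) (Cpow u n))).
  { unfold w. rewrite <- HFD. unfold e. fold c. field. exact HQ0. }
  assert (Bw : Cmod w * Cmod Qu <= K1 * Cmod u ^ S n + Cmod e * (L * Cmod u) * Cmod u ^ n).
  { rewrite <- Cmod_mult, Ew. unfold Cminus at 1. eapply Rle_trans; [apply Cmod_triangle|].
    rewrite Cmod_opp. apply Rplus_le_compat; [exact HT|].
    rewrite !Cmod_mult, Cmod_pow. apply Rmult_le_compat_r; [apply pow_le, Cmod_ge_0|].
    apply Rmult_le_compat_l; [apply Cmod_ge_0|exact HQl]. }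
  assert (Bw' : Cmod w * (m / 2) <= (K1 + Cmod e * L) * Cmod u ^ S n).
  { eapply Rle_trans; [apply Rmult_le_compat_l; [apply Cmod_ge_0|exact HQb]|].
    eapply Rle_trans; [exact Bw|]. right. simpl. ring. }
  replace (Cmod w) with (2 / m * (Cmod w * (m / 2))) by (field; lra).
  rewrite Rmult_assoc. apply Rmult_le_compat_l; [|exact Bw'].
  apply Rlt_le, Rdiv_lt_0_compat; lra.
- left. exists r0; split; [exact Hr0|]. intros u Hu.
  assert (E : D u = RtoC 0).
  { apply (sums_unique (fun n => Cmult (dc n) (Cpow u n))); [apply HD; apply Hr0'; exact Hu|].
    assert (Hz : forall i, Cmult (dc i) (Cpow u i) = RtoC 0).
    { intros i. replace (dc i) with (RtoC 0); [ring|].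
      symmetry. apply NNPP. intros Hi; apply Hno; exists i; exact Hi. }
    rewrite <- (Hz O). apply (sums_first (fun n => Cmult (dc n) (Cpow u n))). intros i; apply Hz. }
  rewrite <- HFD in E by exact Hu. specialize (HQn u Hu).
  replace (F (Cplus z0 u)) with
    (Cplus (Cmult (Cmult (Cminus (F (Cplus z0 u)) c) (Q (Cplus z0 u))) (Cinv (Q (Cplus z0 u)))) c)
    by (field; exact HQn).
  rewrite E; ring.
Qed.

(** * Maximum principle *)

(** The local input of the maximum principle; it is stable under forming quotients of
    analytic functions, including at removable singularities. *)
Definition no_strict_max_at (F : C -> C) (z : C) : Prop :=
  (forall eps, 0 < eps -> exists d, 0 < d /\
     forall w, Cmod (Cminus w z) < d -> Cmod (Cminus (F w) (F z)) < eps) /\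
  ((exists d, 0 < d /\ forall w, Cmod (Cminus w z) < d -> F w = F z) \/
   (forall d, 0 < d -> exists w, Cmod (Cminus w z) < d /\ Cmod (F z) < Cmod (F w))).

(** If the leading term is not constant, move in a direction in which it points the same
    way as [F z0]; such a direction exists because unit complex numbers have roots. *)
Lemma quotient_no_strict_max P Q F z0 d :
  analytic_at P z0 -> analytic_at Q z0 -> Q z0 <> RtoC 0 -> 0 < d ->
  (forall w, Cmod (Cminus w z0) < d -> Cmult (F w) (Q w) = P w) ->
  no_strict_max_at F z0.
Proof.
intros HP HQ HQ0 Hd HF.
assert (Ez : forall w, Cplus z0 (Cminus w z0) = w) by (intros; ring).
destruct (quotient_leading_term P Q F z0 d HP HQ HQ0 Hd) as
  [(r & Hr & Hc)|(n & e & K & r & Hn & He & Hr & HK)].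
- intros u Hu. apply HF. replace (Cminus (Cplus z0 u) z0) with u by ring. exact Hu.
- split.
  + intros eps Heps. exists r; split; [exact Hr|]. intros w Hw.
    specialize (Hc _ Hw). rewrite Ez in Hc. rewrite Hc.
    replace (Cminus _ _) with (RtoC 0) by ring. rewrite Cmod_0; exact Heps.
  + left. exists r; split; [exact Hr|]. intros w Hw.
    specialize (Hc _ Hw). rewrite Ez in Hc. exact Hc.
- assert (He' : 0 < Cmod e) by (apply Cmod_gt_0; exact He).
  split.
  + intros eps Heps.
    set (M := Cmod e + Rabs K).
    assert (HM : 0 < M) by (unfold M; generalize (Rabs_pos K); lra).
    exists (Rmin (Rmin r 1) (eps / M)). split.
    { repeat apply Rmin_pos; try lra. apply Rdiv_lt_0_compat; lra. }
    intros w Hw. set (u := Cminus w z0) in *.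
    assert (A0 : Cmod u < Rmin r 1) by (eapply Rlt_le_trans; [exact Hw|apply Rmin_l]).
    assert (A1 : Cmod u < r) by (eapply Rlt_le_trans; [exact A0|apply Rmin_l]).
    assert (A2 : Cmod u < 1) by (eapply Rlt_le_trans; [exact A0|apply Rmin_r]).
    assert (A3 : Cmod u < eps / M) by (eapply Rlt_le_trans; [exact Hw|apply Rmin_r]).
    specialize (HK u A1). unfold u in HK at 1. rewrite Ez in HK.
    replace (Cminus (F w) (F z0)) with
      (Cplus (Cminus (F w) (Cplus (F z0) (Cmult e (Cpow u n)))) (Cmult e (Cpow u n))) by ring.
    eapply Rle_lt_trans; [apply Cmod_triangle|]. rewrite Cmod_mult, Cmod_pow.
    assert (B1 : Cmod u ^ n <= Cmod u).
    { destruct n as [|n]; [lia|]. simpl.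
      assert (Cmod u ^ n <= 1) by (rewrite <- (pow1 n); apply pow_incr; split; [apply Cmod_ge_0|lra]).
      generalize (Cmod_ge_0 u); nra. }
    assert (B0 : 0 <= Cmod u ^ n) by (apply pow_le, Cmod_ge_0).
    simpl in HK. apply Rlt_div_r in A3; [|exact HM]. unfold M in A3.
    generalize (Cmod_ge_0 u) (Rle_abs K) (Rabs_pos K); intros.
    assert (K * (Cmod u * Cmod u ^ n) <= Rabs K * Cmod u).
    { apply Rle_trans with (Rabs K * (Cmod u * Cmod u ^ n)); [apply Rmult_le_compat_r; nra|].
      apply Rmult_le_compat_l; nra. }
    nra.
  + right. intros d' Hd'.
    destruct (polar (F z0)) as (vc & Hvc & Ec). destruct (polar e) as (ve & Hve & Ee).
    assert (Hve0 : ve <> RtoC 0) by (apply Cmod_gt_0; lra).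
    destruct (unit_root (Cdiv vc ve) n) as (v & Hv & Hvn); [|exact Hn|].
    { rewrite Cmod_div by exact Hve0. rewrite Hvc, Hve. field. }
    set (t := Rmin (Rmin r d') (Cmod e / (Rabs K + 1)) / 2).
    assert (Ht0 : 0 < Rmin (Rmin r d') (Cmod e / (Rabs K + 1))).
    { repeat apply Rmin_pos; try lra. apply Rdiv_lt_0_compat; [lra|]. generalize (Rabs_pos K); lra. }
    assert (Ht1 : Rmin (Rmin r d') (Cmod e / (Rabs K + 1)) <= Rmin r d') by apply Rmin_l.
    assert (Ht2 : Rmin (Rmin r d') (Cmod e / (Rabs K + 1)) <= Cmod e / (Rabs K + 1)) by apply Rmin_r.
    assert (Ht3 : Rmin r d' <= r) by apply Rmin_l.
    assert (Ht4 : Rmin r d' <= d') by apply Rmin_r.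
    assert (Ht : 0 < t) by (unfold t; lra).
    assert (Ht5 : t < Cmod e / (Rabs K + 1)) by (unfold t; lra).
    set (u := Cmult (RtoC t) v).
    assert (Hu : Cmod u = t) by (unfold u; rewrite Cmod_mult, Cmod_R, Hv, Rabs_pos_eq; lra).
    exists (Cplus z0 u). split.
    { replace (Cminus (Cplus z0 u) z0) with u by ring. rewrite Hu; unfold t; lra. }
    specialize (HK u ltac:(rewrite Hu; unfold t; lra)).
    assert (E : Cplus (F z0) (Cmult e (Cpow u n)) = Cmult (RtoC (Cmod (F z0) + Cmod e * t ^ n)) vc).
    { unfold u. rewrite Cpow_mult_l, Hvn, <- RtoC_pow, RtoC_plus, RtoC_mult.
      rewrite Ec at 1. rewrite Ee at 1. field. exact Hve0. }
    rewrite E in HK.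
    assert (Htn : 0 < t ^ n) by (apply pow_lt; exact Ht).
    assert (Hbig : Cmod (Cmult (RtoC (Cmod (F z0) + Cmod e * t ^ n)) vc) = Cmod (F z0) + Cmod e * t ^ n).
    { rewrite Cmod_mult, Cmod_R, Hvc, Rabs_pos_eq; [ring|].
      generalize (Cmod_ge_0 (F z0)); nra. }
    generalize (Cmod_triangle_rev (Cmult (RtoC (Cmod (F z0) + Cmod e * t ^ n)) vc) (F (Cplus z0 u))).
    rewrite Cmod_minus_sym, Hbig. rewrite Hu in HK. simpl in HK.
    apply Rlt_div_r in Ht5; [|generalize (Rabs_pos K); lra].
    assert (K * (t * t ^ n) < Cmod e * t ^ n).
    { rewrite <- Rmult_assoc. apply Rmult_lt_compat_r; [exact Htn|].
      generalize (Rle_abs K); nra. }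
    lra.
Qed.

Lemma analytic_no_strict_max F z : analytic_at F z -> no_strict_max_at F z.
Proof.
intros H. apply (quotient_no_strict_max F (fun _ => RtoC 1) F z 1).
- exact H.
- apply analytic_at_const.
- intros E; injection E; lra.
- lra.
- intros; ring.
Qed.

(** A Lebesgue number: compactness of a square suffices once the gauge at a point outside
    the disc is its distance to the disc, since such a point then covers nothing. *)
Lemma closed_disc_gauge r (delta : C -> R) : (forall z, 0 < delta z) ->
  exists d, 0 < d /\ forall z, Cmod z <= r ->
    exists z0, Cmod z0 <= r /\ Cmod (Cminus z z0) < delta z0 /\ d <= delta z0.
Proof.
intros Hdelta.
set (g := fun x y : R => if Rle_dec (Cmod (x, y)) r then delta (x, y) / 2 else (Cmod (x, y) - r) / 2).
assert (Hg : forall x y, 0 < g x y).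
{ intros x y; unfold g; destruct (Rle_dec (Cmod (x, y)) r); [specialize (Hdelta (x, y))|]; lra. }
destruct (compactness_value_2d (- r) r (- r) r (fun x y => mkposreal _ (Hg x y))) as [d Hd].
exists d; split; [apply cond_pos|]. intros [x y] Hz.
generalize (Rmax_Cmod (x, y)); simpl; intros Hmax.
assert (Hx : Rabs x <= r) by (eapply Rle_trans; [apply Rmax_l|]; eapply Rle_trans; eassumption).
assert (Hy : Rabs y <= r) by (eapply Rle_trans; [apply Rmax_r|]; eapply Rle_trans; eassumption).
apply Rabs_le_between in Hx. apply Rabs_le_between in Hy.
apply NNPP. intros Hno. apply (Hd x y Hx Hy). intros (a & b & _ & _ & Hxa & Hyb & Hdg).
simpl in Hxa, Hyb, Hdg.
assert (Hdist : Cmod (Cminus (x, y) (a, b)) < 2 * g a b).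
{ replace (Cminus (x, y) (a, b)) with (Cplus (RtoC (x - a)) (Cmult Ci (RtoC (y - b)))).
  - eapply Rle_lt_trans; [apply Cmod_triangle|]. rewrite Cmod_mult, Cmod_Ci, !Cmod_R. lra.
  - unfold Cminus, Cplus, Copp, Cmult, Ci, RtoC; simpl; f_equal; ring. }
apply Hno. exists (a, b). unfold g in *. destruct (Rle_dec (Cmod (a, b)) r) as [Hab|Hab].
- split; [exact Hab|]. split; [lra|]. specialize (Hdelta (a, b)). lra.
- exfalso. generalize (Cmod_triangle_rev (a, b) (x, y)). rewrite Cmod_minus_sym. lra.
Qed.

(** Semicontinuity rather than continuity, because the second use of this lemma is on a
    function that jumps down off a level set. *)
Lemma closed_disc_usc_max r (phi : C -> R) : 0 <= r ->
  (forall z, Cmod z <= r -> forall eps, 0 < eps -> exists d, 0 < d /\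
     forall w, Cmod w <= r -> Cmod (Cminus w z) < d -> phi w < phi z + eps) ->
  exists z, Cmod z <= r /\ forall w, Cmod w <= r -> phi w <= phi z.
Proof.
intros Hr Husc.
assert (Hgauge : forall eps : C -> R, (forall z, 0 < eps z) ->
   exists delta : C -> R, (forall z, 0 < delta z /\ delta z <= eps z) /\ forall z, Cmod z <= r ->
     forall w, Cmod w <= r -> Cmod (Cminus w z) < delta z -> phi w < phi z + eps z).
{ intros eps Heps.
  assert (Hex : forall z, exists d, (0 < d /\ d <= eps z) /\ (Cmod z <= r ->
     forall w, Cmod w <= r -> Cmod (Cminus w z) < d -> phi w < phi z + eps z)).
  { intros z. destruct (Rle_or_lt (Cmod z) r) as [Hz|Hz].
    - destruct (Husc z Hz (eps z) (Heps z)) as (d & Hd & H).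
      exists (Rmin d (eps z)). split; [split; [apply Rmin_pos; auto|apply Rmin_r]|].
      intros _ w Hw Hwz. apply H; [exact Hw|]. eapply Rlt_le_trans; [exact Hwz|apply Rmin_l].
    - exists (eps z). split; [split; [auto|lra]|]. intros; lra. }
  exists (fun z => proj1_sig (constructive_indefinite_description _ (Hex z))).
  split; intros z; destruct (constructive_indefinite_description _ (Hex z)) as [d [H1 H2]]; simpl; auto. }
(* a gauge below 1/(1+|phi|) bounds phi above *)
destruct (Hgauge (fun z => / (1 + Rabs (phi z)))) as (d1 & Hd1 & H1).
{ intros z; apply Rinv_0_lt_compat; generalize (Rabs_pos (phi z)); lra. }
destruct (closed_disc_gauge r d1) as (m1 & Hm1 & C1); [intros z; apply Hd1|].
set (E := fun x => exists z, Cmod z <= r /\ x = phi z).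
destruct (completeness E) as [M [HM1 HM2]].
{ exists (/ m1). intros x (z & Hz & ->).
  destruct (C1 z Hz) as (z0 & Hz0 & Hzz & Hm). specialize (H1 z0 Hz0 z Hz Hzz).
  destruct (Hd1 z0) as [Hp Hle].
  assert (Ha : 0 < 1 + Rabs (phi z0)) by (generalize (Rabs_pos (phi z0)); lra).
  assert (/ (1 + Rabs (phi z0)) <= 1).
  { rewrite <- Rinv_1. apply Rinv_le_contravar; generalize (Rabs_pos (phi z0)); lra. }
  apply Rle_trans with (1 + Rabs (phi z0)); [generalize (Rle_abs (phi z0)); lra|].
  rewrite <- (Rinv_inv (1 + Rabs (phi z0))). apply Rinv_le_contravar; lra. }
{ exists (phi (RtoC 0)), (RtoC 0). rewrite Cmod_0. split; [exact Hr|reflexivity]. }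
apply NNPP. intros Hno.
assert (Hlt : forall z, Cmod z <= r -> phi z < M).
{ intros z Hz. destruct (Rle_or_lt M (phi z)) as [Hge|Hlt]; [|exact Hlt].
  exfalso; apply Hno. exists z. split; [exact Hz|]. intros w Hw.
  apply Rle_trans with M; [apply HM1; exists w; auto|exact Hge]. }
(* a gauge below half the distance to the supremum bounds phi away from it *)
destruct (Hgauge (fun z => if Rlt_dec (phi z) M then (M - phi z) / 2 else 1)) as (d2 & Hd2 & H2).
{ intros z; destruct (Rlt_dec (phi z) M); lra. }
destruct (closed_disc_gauge r d2) as (m2 & Hm2 & C2); [intros z; apply Hd2|].
assert (M <= M - m2); [|lra].
apply HM2. intros x (z & Hz & ->).
destruct (C2 z Hz) as (z0 & Hz0 & Hzz & Hm). specialize (H2 z0 Hz0 z Hz Hzz).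
destruct (Hd2 z0) as [_ Hle]. specialize (Hlt z0 Hz0).
destruct (Rlt_dec (phi z0) M); lra.
Qed.

(** Among the points where the modulus is maximal take one farthest from the origin: if
    it were interior the function would be constant around it, and a point slightly
    farther away would do as well. *)
Lemma maximum_principle F r M : 0 < r ->
  (forall z, Cmod z <= r -> no_strict_max_at F z) ->
  (forall z, Cmod z = r -> Cmod (F z) <= M) ->
  forall z, Cmod z <= r -> Cmod (F z) <= M.
Proof.
intros Hr Hloc Hbd.
assert (Hcont : forall z, Cmod z <= r -> forall eps, 0 < eps -> exists d, 0 < d /\
   forall w, Cmod (Cminus w z) < d -> Rabs (Cmod (F w) - Cmod (F z)) < eps).
{ intros z Hz eps He. destruct (Hloc z Hz) as [Hc _]. destruct (Hc eps He) as (d & Hd & H).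
  exists d; split; [exact Hd|]. intros w Hw. specialize (H w Hw).
  generalize (Cmod_triangle_rev (F w) (F z)) (Cmod_triangle_rev (F z) (F w)).
  rewrite (Cmod_minus_sym (F z) (F w)). intros. apply Rabs_def1; lra. }
destruct (closed_disc_usc_max r (fun z => Cmod (F z))) as (z1 & Hz1 & Hmax1); [lra| |].
{ intros z Hz eps He. destruct (Hcont z Hz eps He) as (d & Hd & H). exists d; split; [exact Hd|].
  intros w _ Hw. specialize (H w Hw). apply Rabs_def2 in H. lra. }
destruct (Rle_or_lt (Cmod (F z1)) M) as [Hle|Hgt].
{ intros z Hz. apply Rle_trans with (Cmod (F z1)); auto. }
exfalso.
set (phi := fun z => if Req_EM_T (Cmod (F z)) (Cmod (F z1)) then Cmod z else -1).
destruct (closed_disc_usc_max r phi) as (z2 & Hz2 & Hmax2); [lra| |].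
{ intros z Hz eps He. unfold phi. destruct (Req_EM_T (Cmod (F z)) (Cmod (F z1))) as [Ez|Nz].
  - exists eps; split; [exact He|]. intros w _ Hw.
    generalize (Cmod_ge_0 z) (Cmod_triangle_rev w z).
    destruct (Req_EM_T (Cmod (F w)) (Cmod (F z1))); lra.
  - destruct (Hcont z Hz (Rabs (Cmod (F z) - Cmod (F z1)))) as (d & Hd & H).
    { apply Rabs_pos_lt; lra. }
    exists d; split; [exact Hd|]. intros w _ Hw. specialize (H w Hw).
    destruct (Req_EM_T (Cmod (F w)) (Cmod (F z1))) as [Ew|_]; [|lra].
    rewrite Ew, Rabs_minus_sym in H. lra. }
assert (E2 : Cmod (F z2) = Cmod (F z1)).
{ specialize (Hmax2 z1 Hz1). unfold phi in Hmax2.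
  destruct (Req_EM_T (Cmod (F z1)) (Cmod (F z1))) as [_|N]; [|congruence].
  destruct (Req_EM_T (Cmod (F z2)) (Cmod (F z1))) as [E|_]; [exact E|].
  generalize (Cmod_ge_0 z1); lra. }
assert (Hin : Cmod z2 < r).
{ destruct (Req_dec (Cmod z2) r) as [E|]; [|lra]. specialize (Hbd z2 E). lra. }
destruct (Hloc z2 Hz2) as [_ [(d & Hd & Hconst)|Hbig]].
- destruct (polar z2) as (v & Hv & Ev).
  set (t := Rmin d (r - Cmod z2) / 2).
  assert (Ht : 0 < t /\ t < d /\ t < r - Cmod z2).
  { assert (0 < Rmin d (r - Cmod z2)) by (apply Rmin_pos; lra).
    generalize (Rmin_l d (r - Cmod z2)) (Rmin_r d (r - Cmod z2)). unfold t; lra. }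
  set (w := Cmult (RtoC (Cmod z2 + t)) v).
  assert (Hw : Cmod w = Cmod z2 + t).
  { unfold w. rewrite Cmod_mult, Hv, Cmod_R, Rabs_pos_eq; [ring|]. generalize (Cmod_ge_0 z2); lra. }
  assert (Hwz : Cmod (Cminus w z2) < d).
  { replace (Cminus w z2) with (Cmult (RtoC t) v).
    - rewrite Cmod_mult, Hv, Cmod_R, Rabs_pos_eq; lra.
    - unfold w. rewrite Ev at 2. rewrite RtoC_plus. ring. }
  specialize (Hconst w Hwz). specialize (Hmax2 w ltac:(lra)). unfold phi in Hmax2.
  rewrite Hconst in Hmax2.
  destruct (Req_EM_T (Cmod (F z2)) (Cmod (F z1))); [lra|contradiction].
- destruct (Hbig (r - Cmod z2)) as (w & Hw & Hlt); [lra|].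
  specialize (Hmax1 w). generalize (Cmod_triangle_rev w z2). lra.
Qed.

(** * The lemmas of Schwarz and Schwarz--Pick *)

Lemma sup_norm_le_1 h :
  Rbar_le (sup_norm h) (Finite 1) <-> forall z, Cmod z < 1 -> Cmod (h z) <= 1.
Proof.
unfold sup_norm. set (E := fun x : R => _).
destruct (Lub_Rbar_correct E) as [Hub Hlub]. split.
- intros H z Hz. apply (Rbar_le_trans (Cmod (h z)) (Lub_Rbar E) 1); [|exact H].
  apply Hub. exists z; auto.
- intros H. apply Hlub. intros x (z & Hz & ->). exact (H z Hz).
Qed.

Lemma ex_derive_continuity_pt (phi : R -> R) x : ex_derive phi x -> continuity_pt phi x.
Proof.
intros H. apply continuity_pt_filterlim.
exact (ex_derive_continuous (K := R_AbsRing) (V := R_NormedModule) phi x H).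
Qed.

Lemma le_limit_at_1 (phi : R -> R) x r0 : r0 < 1 -> continuity_pt phi 1 ->
  (forall r, r0 < r < 1 -> x <= phi r) -> x <= phi 1.
Proof.
intros Hr0 Hc H. apply le_epsilon; intros eps He.
destruct (Hc eps He) as (d & Hd & Hphi).
set (r := 1 - Rmin d (1 - r0) / 2).
assert (Hm : 0 < Rmin d (1 - r0)) by (apply Rmin_pos; lra).
generalize (Rmin_l d (1 - r0)) (Rmin_r d (1 - r0)); intros.
assert (Hr : r0 < r < 1) by (unfold r; lra).
specialize (H r Hr). specialize (Hphi r). simpl in Hphi. unfold R_dist in Hphi.
assert (Rabs (phi r - phi 1) < eps).
{ apply Hphi. split; [split; [exact I|lra]|]. rewrite Rabs_left; unfold r in *; lra. }
generalize (Rle_abs (phi r - phi 1)); lra.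
Qed.

Lemma has_ps_div_pow c rho W : 0 < rho -> has_ps c rho W -> forall j,
  (forall i, (i < j)%nat -> c i = RtoC 0) ->
  has_ps (fun n => c (j + n)%nat) rho
    (fun u => if excluded_middle_informative (u = RtoC 0) then c j else Cdiv (W u) (Cpow u j)).
Proof.
intros Hr H. induction j as [|j IH]; intros H0.
- apply has_ps_ext with (2 := H). intros u Hu.
  destruct (excluded_middle_informative (u = RtoC 0)) as [->|Hu0].
  + apply (has_ps_0 c rho W); assumption.
  + simpl. field.
- specialize (IH (fun i Hi => H0 i (Nat.lt_lt_succ_r _ _ Hi))).
  intros u Hu. apply sums_ext with (fun n => Cmult (c (j + S n)%nat) (Cpow u n));
    [intros n; do 2 f_equal; lia|].
  revert u Hu. change (has_ps (fun n => (fun n => c (j + n)%nat) (S n)) rho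
    (fun u => if excluded_middle_informative (u = RtoC 0) then c (S j) else Cdiv (W u) (Cpow u (S j)))).
  eapply has_ps_div_id; [exact Hr|exact IH| | |].
  + rewrite Nat.add_0_r; apply H0; lia.
  + intros u Hu Hu0. cbv beta.
    destruct (excluded_middle_informative (u = RtoC 0)); [contradiction|].
    rewrite Cpow_S. field. split; [apply Cpow_nz|]; exact Hu0.
  + destruct (excluded_middle_informative (RtoC 0 = RtoC 0)); [|congruence].
    f_equal; lia.
Qed.

(** The quotient [w z / z^j] has a removable singularity at 0 and modulus at most [1 / r^j]
    on [|z| = r]; let [r] tend to 1. *)
Lemma schwarz j w : class_Bj j w -> forall z, Cmod z < 1 -> Cmod (w z) <= Cmod z ^ j.
Proof.
intros [[Han Hle] [Hlow _]] z Hz.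
rewrite analytic_on_disc_at in Han. rewrite sup_norm_le_1 in Hle.
assert (H1 : Cmod (RtoC 0) < 1) by (rewrite Cmod_0; lra).
destruct (Han _ H1) as (c & rho & Hr & H).
assert (H' : has_ps c rho w) by (apply has_ps_ext with (2 := H); intros u _; f_equal; ring).
assert (H0 : forall i, (i < j)%nat -> c i = RtoC 0).
{ intros i Hi. specialize (Hlow i Hi). rewrite (C_derive_n_0 c rho) in Hlow by assumption.
  apply NNPP; intros Hc. revert Hlow. apply Cmult_neq_0; [|exact Hc].
  intros E; injection E; apply INR_fact_neq_0. }
pose proof (has_ps_div_pow c rho w Hr H' j H0) as HF.
set (F := fun u : C => if excluded_middle_informative (u = RtoC 0) then c j else Cdiv (w u) (Cpow u j)) in HF.
assert (HFnz : forall u, u <> RtoC 0 -> Cmult (F u) (Cpow u j) = w u).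
{ intros u Hu. unfold F. destruct (excluded_middle_informative (u = RtoC 0)); [contradiction|].
  field. apply Cpow_nz; exact Hu. }
assert (Hloc : forall u, Cmod u < 1 -> no_strict_max_at F u).
{ intros u Hu. destruct (classic (u = RtoC 0)) as [->|Hu0].
  - apply analytic_no_strict_max. exists (fun n => c (j + n)%nat), rho. split; [exact Hr|].
    apply has_ps_ext with (2 := HF). intros v _; f_equal; ring.
  - apply (quotient_no_strict_max w (fun v => Cpow v j) F u (Cmod u)).
    + apply Han; exact Hu.
    + apply analytic_at_pow.
    + apply Cpow_nz; exact Hu0.
    + apply Cmod_gt_0; exact Hu0.
    + intros v Hv. apply HFnz. intros ->.
      replace (Cminus 0 u) with (Copp u) in Hv by ring. rewrite Cmod_opp in Hv. lra. }
assert (HFz : Cmod (F z) <= 1).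
{ replace 1 with (/ 1 ^ j) by (rewrite pow1; field).
  apply (le_limit_at_1 (fun r => / r ^ j) _ (Cmod z) Hz).
  - apply continuity_pt_inv.
    + apply derivable_continuous_pt, derivable_pt_pow.
    + rewrite pow1; lra.
  - intros r Hr1. generalize (Cmod_ge_0 z); intros Hz0.
    apply (maximum_principle F r); [lra| | |lra].
    + intros u Hu; apply Hloc; lra.
    + intros u Hu. assert (Hu0 : u <> RtoC 0) by (apply Cmod_gt_0; lra).
      specialize (HFnz u Hu0). specialize (Hle u ltac:(lra)).
      rewrite <- HFnz, Cmod_mult, Cmod_pow, Hu in Hle.
      assert (0 < r ^ j) by (apply pow_lt; lra).
      rewrite <- (Rmult_1_l (/ r ^ j)). apply Rle_div_r; assumption. }
destruct (classic (z = RtoC 0)) as [->|Hz0].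
- rewrite Cmod_0. destruct j as [|j].
  + simpl. apply Hle, H1.
  + rewrite (has_ps_0 c rho w Hr H'), H0 by lia. rewrite Cmod_0. apply pow_le; lra.
- rewrite <- (HFnz z Hz0), Cmod_mult, Cmod_pow.
  rewrite <- (Rmult_1_l (Cmod z ^ j)) at 2.
  apply Rmult_le_compat_r; [apply pow_le, Cmod_ge_0|exact HFz].
Qed.

(** The identity behind the invariance of the pseudo-hyperbolic distance. *)
Lemma pick_identity a b :
  Cmod (Cminus (RtoC 1) (Cmult (Cconj a) b)) ^ 2 - Cmod (Cminus b a) ^ 2 =
  (1 - Cmod a ^ 2) * (1 - Cmod b ^ 2).
Proof.
rewrite !Cmod2_alt. destruct a as [a1 a2], b as [b1 b2]. simpl. ring.
Qed.

Lemma one_minus_conj_mult_neq_0 a b : Cmod a < 1 -> Cmod b <= 1 ->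
  Cminus (RtoC 1) (Cmult (Cconj a) b) <> RtoC 0.
Proof.
intros Ha Hb E. assert (E1 : Cmult (Cconj a) b = RtoC 1).
{ replace (Cmult (Cconj a) b) with (Cminus (RtoC 1) (Cminus (RtoC 1) (Cmult (Cconj a) b))) by ring.
  rewrite E; ring. }
assert (E2 : Cmod (Cmult (Cconj a) b) = 1) by (rewrite E1; apply Cmod_1).
rewrite Cmod_mult, Cmod_conj in E2. generalize (Cmod_ge_0 a) (Cmod_ge_0 b); nra.
Qed.

(** The value at [z0] makes the quotient analytic there, so that the maximum principle
    bounds the derivative together with the difference quotients. *)
Definition diff_quot (h : C -> C) (z0 z : C) : C :=
  if excluded_middle_informative (z = z0) then C_derive h z0
  else Cdiv (Cminus (h z) (h z0)) (Cminus z z0).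

Lemma diff_quot_spec h z0 z :
  Cmult (diff_quot h z0 z) (Cminus z z0) = Cminus (h z) (h z0).
Proof.
unfold diff_quot. destruct (excluded_middle_informative (z = z0)) as [->|Hz].
- ring.
- field. intros E; apply Hz. replace z with (Cplus (Cminus z z0) z0) by ring. rewrite E; ring.
Qed.

Lemma diff_quot_analytic h z0 : analytic_at h z0 -> analytic_at (diff_quot h z0) z0.
Proof.
intros (c & rho & Hr & H).
pose proof (has_ps_0 _ _ _ Hr H) as E0. cbv beta in E0.
replace (Cplus z0 (RtoC 0)) with z0 in E0 by ring.
exists (fun n => Cplus (Cmult 1 (c (S n))) (Cmult (-1) (coeff_const (h z0) (S n)))), rho.
split; [exact Hr|].
apply (has_ps_div_id (fun n => Cplus (Cmult 1 (c n)) (Cmult (-1) (coeff_const (h z0) n))) rho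
  (fun u => Cplus (Cmult 1 (h (Cplus z0 u))) (Cmult (-1) (h z0)))).
- exact Hr.
- apply (has_ps_lin 1 (-1) c (coeff_const (h z0)) rho (fun u => h (Cplus z0 u)) (fun _ => h z0));
    [exact H|apply has_ps_const].
- simpl. rewrite E0. replace (RtoC (-1)) with (Copp (RtoC 1)) by (rewrite <- RtoC_opp; f_equal). ring.
- intros u _ _. cbv beta. generalize (diff_quot_spec h z0 (Cplus z0 u)).
  replace (Cminus (Cplus z0 u) z0) with u by ring. intros E.
  rewrite (Cmult_comm u), E.
  replace (RtoC (-1)) with (Copp (RtoC 1)) by (rewrite <- RtoC_opp; f_equal). ring.
- cbv beta. replace (Cplus z0 (RtoC 0)) with z0 by ring. unfold diff_quot.
  destruct (excluded_middle_informative (z0 = z0)); [|congruence].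
  rewrite (C_derive_ps c rho h z0 Hr H). simpl. ring.
Qed.

Section SchwarzPick.

Variables (h : C -> C) (z0 : C).
Hypothesis h_analytic : forall z, Cmod z < 1 -> analytic_at h z.
Hypothesis h_le_1 : forall z, Cmod z < 1 -> Cmod (h z) <= 1.
Hypothesis z0_lt_1 : Cmod z0 < 1.
Hypothesis hz0_lt_1 : Cmod (h z0) < 1.

Let denom (z : C) : C := Cminus (RtoC 1) (Cmult (Cconj (h z0)) (h z)).
Let numer (z : C) : C := Cminus (RtoC 1) (Cmult (Cconj z0) z).

Let H (z : C) : C := Cdiv (Cmult (numer z) (diff_quot h z0 z)) (denom z).

Local Lemma denom_neq_0 z : Cmod z < 1 -> denom z <> RtoC 0.
Proof. intros Hz; apply one_minus_conj_mult_neq_0; auto. Qed.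

Local Lemma denom_analytic z : Cmod z < 1 -> analytic_at denom z.
Proof.
intros Hz.
apply analytic_at_ext with (fun w => Cplus (Cmult (RtoC 1) (RtoC 1)) (Cmult (Copp (Cconj (h z0))) (h w))).
- intros w; unfold denom; ring.
- apply analytic_at_lin; [apply analytic_at_const|auto].
Qed.

Local Lemma H_no_strict_max z : Cmod z < 1 -> no_strict_max_at H z.
Proof.
intros Hz. set (d := 1 - Cmod z).
assert (Hd : 0 < d) by (unfold d; lra).
assert (Hin : forall w, Cmod (Cminus w z) < d -> Cmod w < 1).
{ intros w Hw. generalize (Cmod_triangle_rev w z). unfold d in Hw; lra. }
destruct (classic (z = z0)) as [->|Hz0].
- apply (quotient_no_strict_max
    (fun w => Cmult (Cplus (RtoC 1) (Cmult (Copp (Cconj z0)) w)) (diff_quot h z0 w)) denom H z0 d).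
  + apply analytic_at_affine_mul, diff_quot_analytic, h_analytic, Hz.
  + apply denom_analytic, Hz.
  + apply denom_neq_0, Hz.
  + exact Hd.
  + intros w Hw. unfold H, numer. field. apply denom_neq_0, Hin, Hw.
- apply (quotient_no_strict_max
    (fun w => Cmult (Cplus (RtoC 1) (Cmult (Copp (Cconj z0)) w))
       (Cplus (Cmult (RtoC 1) (h w)) (Cmult (RtoC 1) (Copp (h z0)))))
    (fun w => Cmult (Cplus (Copp z0) (Cmult (RtoC 1) w)) (denom w)) H z d).
  + apply analytic_at_affine_mul, analytic_at_lin; [auto|apply analytic_at_const].
  + apply analytic_at_affine_mul, denom_analytic, Hz.
  + apply Cmult_neq_0; [|apply denom_neq_0, Hz].
    intros E; apply Hz0. replace z with (Cplus (Cplus (Copp z0) (Cmult (RtoC 1) z)) z0) by ring.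
    rewrite E; ring.
  + exact Hd.
  + intros w Hw. unfold H, numer.
    replace (Cplus (Cmult (RtoC 1) (h w)) (Cmult (RtoC 1) (Copp (h z0)))) with (Cminus (h w) (h z0)) by ring.
    rewrite <- diff_quot_spec. field. apply denom_neq_0, Hin, Hw.
Qed.

(** On [|z| = r] the Blaschke factor of [h] has modulus at most 1, and that of [z]
    tends to 1 as [r] tends to 1. *)
Local Lemma H_boundary r z : Cmod z0 < r < 1 -> Cmod z = r ->
  Cmod (H z) <= 1 + (1 - r ^ 2) / (r - Cmod z0) ^ 2.
Proof.
intros Hr Hz.
assert (Hz1 : Cmod z < 1) by lra.
assert (Hden : 0 < Cmod (denom z)) by (apply Cmod_gt_0, denom_neq_0, Hz1).
assert (Hdz : r - Cmod z0 <= Cmod (Cminus z z0)) by (rewrite <- Hz; apply Cmod_triangle_rev).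
set (D := Cmod (Cminus z z0)) in *.
assert (E : Cmod (H z) * Cmod (denom z) * D = Cmod (numer z) * Cmod (Cminus (h z) (h z0))).
{ rewrite <- diff_quot_spec. unfold D. rewrite <- !Cmod_mult. f_equal. unfold H. field.
  apply denom_neq_0, Hz1. }
assert (B1 : Cmod (Cminus (h z) (h z0)) <= Cmod (denom z)).
{ generalize (pick_identity (h z0) (h z)). fold (denom z). intros Hp.
  specialize (h_le_1 z Hz1).
  generalize (Cmod_ge_0 (Cminus (h z) (h z0))) (Cmod_ge_0 (h z)) (Cmod_ge_0 (h z0)); intros.
  assert (0 <= (1 - Cmod (h z0) ^ 2) * (1 - Cmod (h z) ^ 2)) by (apply Rmult_le_pos; nra).
  apply Rsqr_incr_0; unfold Rsqr; lra. }
assert (B2 : Cmod (numer z) ^ 2 <= D ^ 2 + (1 - r ^ 2)).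
{ generalize (pick_identity z0 z). fold (numer z). fold D. rewrite Hz. intros Hp.
  assert (0 <= Cmod z0 ^ 2 * (1 - r ^ 2)) by (generalize (Cmod_ge_0 z0); intros; apply Rmult_le_pos; nra). lra. }
assert (B3 : Cmod (H z) * D <= Cmod (numer z)).
{ apply Rmult_le_reg_r with (Cmod (denom z)); [exact Hden|].
  generalize (Cmod_ge_0 (numer z)); nra. }
set (T := (1 - r ^ 2) / (r - Cmod z0) ^ 2).
assert (HT : T * (r - Cmod z0) ^ 2 = 1 - r ^ 2) by (unfold T; field; lra).
assert (Ha0 : 0 <= Cmod z0) by apply Cmod_ge_0.
assert (HT0 : 0 <= T) by (apply Rdiv_le_0_compat; [nra|apply pow_lt; lra]).
assert (HD2 : (r - Cmod z0) ^ 2 <= D ^ 2) by (apply pow_incr; lra).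
assert (B4 : Cmod (numer z) ^ 2 <= ((1 + T) * D) ^ 2).
{ assert (T * (r - Cmod z0) ^ 2 <= T * D ^ 2) by (apply Rmult_le_compat_l; assumption).
  assert (0 <= (T + T ^ 2) * D ^ 2) by (apply Rmult_le_pos; [nra|apply pow2_ge_0]).
  replace (((1 + T) * D) ^ 2) with (D ^ 2 + T * D ^ 2 + (T + T ^ 2) * D ^ 2) by ring. lra. }
apply Rmult_le_reg_r with D; [lra|].
eapply Rle_trans; [exact B3|].
apply Rsqr_incr_0; unfold Rsqr; [lra|apply Cmod_ge_0|nra].
Qed.

Local Lemma H_le_1 z : Cmod z < 1 -> Cmod (H z) <= 1.
Proof.
intros Hz.
set (phi := fun r => 1 + (1 - r ^ 2) / (r - Cmod z0) ^ 2).
replace 1 with (phi 1) by (unfold phi; field; lra).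
apply (le_limit_at_1 phi _ (Rmax (Cmod z) (Cmod z0))).
- apply Rmax_lub_lt; assumption.
- apply ex_derive_continuity_pt.
  unfold phi; auto_derive. apply Rgt_not_eq. nra.
- intros r Hr.
  generalize (Rmax_l (Cmod z) (Cmod z0)) (Rmax_r (Cmod z) (Cmod z0)) (Cmod_ge_0 z); intros.
  apply (maximum_principle H r); [lra| | |lra].
  + intros w Hw; apply H_no_strict_max; lra.
  + intros w Hw; apply H_boundary; [lra|exact Hw].
Qed.

Lemma schwarz_pick z : Cmod z < 1 ->
  Cmod (Cminus (RtoC 1) (Cmult (Cconj z0) z)) * Cmod (Cminus (h z) (h z0)) <=
  Cmod (Cminus (RtoC 1) (Cmult (Cconj (h z0)) (h z))) * Cmod (Cminus z z0).
Proof.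
intros Hz. pose proof (H_le_1 z Hz) as HH.
fold (denom z). fold (numer z).
assert (E : Cmod (H z) * (Cmod (denom z) * Cmod (Cminus z z0)) =
   Cmod (numer z) * Cmod (Cminus (h z) (h z0))).
{ rewrite <- diff_quot_spec. rewrite <- !Cmod_mult. f_equal. unfold H. field.
  apply denom_neq_0, Hz. }
rewrite <- E. rewrite <- Rmult_1_l. apply Rmult_le_compat_r; [|exact HH].
apply Rmult_le_pos; apply Cmod_ge_0.
Qed.

Lemma schwarz_pick_derive :
  Cmod (C_derive h z0) * (1 - Cmod z0 ^ 2) <= 1 - Cmod (h z0) ^ 2.
Proof.
pose proof (H_le_1 z0 z0_lt_1) as HH.
assert (N : forall a, Cmod a < 1 -> Cmod (Cminus (RtoC 1) (Cmult (Cconj a) a)) = 1 - Cmod a ^ 2).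
{ intros a Ha. rewrite Cmult_comm, <- Cmod2_conj, <- RtoC_minus, Cmod_R.
  apply Rabs_pos_eq. generalize (Cmod_ge_0 a); nra. }
assert (E : Cmod (H z0) * Cmod (denom z0) = Cmod (C_derive h z0) * Cmod (numer z0)).
{ rewrite <- !Cmod_mult. f_equal.
  assert (Ed : diff_quot h z0 z0 = C_derive h z0).
  { unfold diff_quot. destruct (excluded_middle_informative (z0 = z0)); congruence. }
  unfold H. rewrite Ed. field. apply denom_neq_0, z0_lt_1. }
unfold denom, numer in E. rewrite !N in E by assumption.
rewrite <- E. rewrite <- (Rmult_1_l (1 - Cmod (h z0) ^ 2)) at 2. apply Rmult_le_compat_r; [|exact HH].
generalize (Cmod_ge_0 (h z0)); nra.
Qed.

End SchwarzPick.

(** A point with [|h z| = 1] would be a maximum of [|h|], around which [h] is constant. *)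
Lemma lt_1_of_derive_neq_0 h z : (forall z, Cmod z < 1 -> analytic_at h z) ->
  (forall z, Cmod z < 1 -> Cmod (h z) <= 1) -> Cmod z < 1 -> C_derive h z <> RtoC 0 ->
  Cmod (h z) < 1.
Proof.
intros Han Hle Hz Hd. destruct (Rle_lt_or_eq_dec _ _ (Hle z Hz)) as [Hlt|E]; [exact Hlt|].
exfalso. destruct (analytic_no_strict_max h z (Han z Hz)) as [_ [(d & Hd0 & Hc)|Hbig]].
- apply Hd. apply C_derive_quadratic with 0 d; [exact Hd0|]. intros v Hv.
  rewrite Hc by (replace (Cminus (Cplus z v) z) with v by ring; exact Hv).
  replace (Cminus _ _) with (RtoC 0) by ring. rewrite Cmod_0; lra.
- destruct (Hbig (1 - Cmod z)) as (w & Hw & Hlt); [lra|].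
  generalize (Cmod_triangle_rev w z); intros. specialize (Hle w ltac:(lra)). lra.
Qed.

(** Put [v = (h z - h 0) / (1 - conj (h 0) h z)]. Then [|v| <= |z|] by Schwarz--Pick, and
    [1 + conj (h 0) v = (1 - |h 0|^2) / (1 - conj (h 0) h z)] bounds the last denominator
    from below, which turns the identity of [pick_identity] into the estimate. *)
Lemma schwarz_pick_at_0 h z : (forall z, Cmod z < 1 -> analytic_at h z) ->
  (forall z, Cmod z < 1 -> Cmod (h z) <= 1) -> Cmod (h (RtoC 0)) < 1 -> Cmod z < 1 ->
  (1 - Cmod (h (RtoC 0)) ^ 2) * (1 - Cmod z ^ 2) <=
  (1 - Cmod (h z) ^ 2) * (1 + Cmod (h (RtoC 0)) * Cmod z) ^ 2.
Proof.
intros Han Hle Ha Hz.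
assert (H0 : Cmod (RtoC 0) < 1) by (rewrite Cmod_0; lra).
pose proof (schwarz_pick h (RtoC 0) Han Hle H0 Ha z Hz) as HS.
replace (Cminus z (RtoC 0)) with z in HS by ring.
assert (E1 : Cmod (Cminus (RtoC 1) (Cmult (Cconj (RtoC 0)) z)) = 1).
{ replace (Cminus (RtoC 1) (Cmult (Cconj (RtoC 0)) z)) with (RtoC 1).
  - apply Cmod_1.
  - destruct z; unfold Cminus, Cplus, Copp, Cmult, Cconj, RtoC; simpl; f_equal; ring. }
rewrite E1, Rmult_1_l in HS.
pose proof (pick_identity (h (RtoC 0)) (h z)) as HP.
set (a := Cmod (h (RtoC 0))) in *. set (x := Cmod z) in *.
set (D := Cmod (Cminus (RtoC 1) (Cmult (Cconj (h (RtoC 0))) (h z)))) in *.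
set (N := Cmod (Cminus (h z) (h (RtoC 0)))) in *.
assert (HD : 1 - a ^ 2 <= D * (1 + a * x)).
{ assert (E : Cplus (Cminus (RtoC 1) (Cmult (Cconj (h (RtoC 0))) (h z)))
     (Cmult (Cconj (h (RtoC 0))) (Cminus (h z) (h (RtoC 0)))) = RtoC (1 - a ^ 2)).
  { rewrite RtoC_minus. unfold a. rewrite Cmod2_conj. ring. }
  apply (f_equal Cmod) in E. rewrite Cmod_R in E.
  generalize (Rle_abs (1 - a ^ 2)). rewrite <- E. intros HA.
  eapply Rle_trans; [exact HA|]. eapply Rle_trans; [apply Cmod_triangle|].
  rewrite Cmod_mult, Cmod_conj. fold D. fold N. fold a.
  assert (0 <= a) by apply Cmod_ge_0. nra. }
assert (Ha0 : 0 <= a) by apply Cmod_ge_0. assert (Hx0 : 0 <= x) by apply Cmod_ge_0.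
assert (HD0 : 0 <= D) by apply Cmod_ge_0. assert (HN0 : 0 <= N) by apply Cmod_ge_0.
assert (Ha2 : 0 < 1 - a ^ 2) by nra.
assert (Hx2 : 0 < 1 - x ^ 2) by nra.
assert (HN : N ^ 2 <= (D * x) ^ 2) by (apply pow_incr; lra).
apply Rmult_le_reg_l with (1 - a ^ 2); [exact Ha2|].
rewrite <- Rmult_assoc, <- Rmult_assoc.
rewrite <- HP.
assert (Hsq : (1 - a ^ 2) ^ 2 <= (D * (1 + a * x)) ^ 2) by (apply pow_incr; lra).
apply Rle_trans with ((D * (1 + a * x)) ^ 2 * (1 - x ^ 2)).
- apply Rmult_le_compat_r; [lra|]. lra.
- assert (0 <= (1 + a * x) ^ 2) by apply pow2_ge_0.
  apply Rle_trans with (D ^ 2 * (1 - x ^ 2) * (1 + a * x) ^ 2); [right; ring|].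
  apply Rmult_le_compat_r; [assumption|]. lra.
Qed.

(** * Parseval's formula by averaging over roots of unity *)

Definition circ_pt (rho : R) (N j : nat) : C :=
  Cmult (RtoC rho) (cis (INR j * (2 * PI / INR N))).

Lemma Cmod_circ_pt rho N j : 0 <= rho -> Cmod (circ_pt rho N j) = rho.
Proof.
intros Hr; unfold circ_pt. rewrite Cmod_mult, Cmod_cis, Cmod_R, Rabs_pos_eq by exact Hr. ring.
Qed.

Lemma Cconj_cis t : Cconj (cis t) = cis (- t).
Proof. unfold cis, Cconj; simpl. rewrite cos_neg, sin_neg. reflexivity. Qed.

Lemma Cconj_R x : Cconj (RtoC x) = RtoC x.
Proof. unfold Cconj, RtoC; simpl. f_equal; ring. Qed.

Lemma cis_neq_1 t : 0 < t < 2 * PI -> cis t <> RtoC 1.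
Proof.
intros Ht E. assert (Hc : cos t = 1) by (change (fst (cis t) = 1); rewrite E; reflexivity).
replace t with (2 * (t / 2)) in Hc by field.
rewrite cos_2a_sin in Hc. assert (0 < sin (t / 2)) by (apply sin_gt_0; lra). nra.
Qed.

Lemma circ_orthogonal rho N l n : (l < n)%nat -> (n < N)%nat ->
  csum (fun j => Cmult (Cconj (Cpow (circ_pt rho N j) l)) (Cpow (circ_pt rho N j) n)) N = RtoC 0.
Proof.
intros Hl Hn.
assert (HN : 0 < INR N) by (apply lt_0_INR; lia).
set (w := cis (INR (n - l) * (2 * PI / INR N))).
rewrite (csum_ext _ (fun j => Cmult (RtoC (rho ^ (l + n))) (Cpow w j))).
2:{ intros j _. unfold circ_pt, w. rewrite !Cpow_mult_l, !cis_pow, Cmult_conj, Cconj_cis, <- !RtoC_pow, Cconj_R.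
    rewrite pow_add, RtoC_mult.
    replace (INR j * (INR (n - l) * (2 * PI / INR N))) with
      (- (INR l * (INR j * (2 * PI / INR N))) + INR n * (INR j * (2 * PI / INR N)))
      by (rewrite minus_INR by lia; ring).
    rewrite cis_plus. ring. }
rewrite csum_scal.
assert (Hw : w <> RtoC 1).
{ apply cis_neq_1. generalize PI_RGT_0; intros HPI.
  assert (0 < INR (n - l)) by (apply lt_0_INR; lia).
  assert (INR (n - l) < INR N) by (apply lt_INR; lia).
  split.
  - apply Rmult_lt_0_compat; [assumption|]. apply Rdiv_lt_0_compat; lra.
  - replace (2 * PI) with (INR N * (2 * PI / INR N)) at 2 by (field; lra).
    apply Rmult_lt_compat_r; [|assumption]. apply Rdiv_lt_0_compat; lra. }
assert (HwN : Cpow w N = RtoC 1).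
{ unfold w. rewrite cis_pow.
  replace (INR N * (INR (n - l) * (2 * PI / INR N))) with (0 + 2 * INR (n - l) * PI) by (field; lra).
  unfold cis. rewrite cos_period, sin_period, cos_0, sin_0. reflexivity. }
assert (HG : forall M, Cmult (Cminus (RtoC 1) w) (csum (fun j => Cpow w j) M) = Cminus (RtoC 1) (Cpow w M)).
{ induction M as [|M IH]; [simpl; ring|]. cbn [csum].
  rewrite Cmult_plus_distr_l, IH, Cpow_S. ring. }
specialize (HG N). rewrite HwN in HG.
assert (Hw1 : Cminus (RtoC 1) w <> RtoC 0) by (apply Cminus_eq_contra; congruence).
assert (HC : csum (fun j => Cpow w j) N = RtoC 0).
{ apply NNPP; intros HC. apply (Cmult_neq_0 _ _ Hw1 HC). rewrite HG; ring. }
etransitivity; [|apply Cmult_0_r]. f_equal. exact HC.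
Qed.

Definition circ_mean (rho : R) (N : nat) (phi : C -> R) : R :=
  / INR N * rsum (fun j => phi (circ_pt rho N j)) N.

Lemma Re_csum f n : Re (csum f n) = rsum (fun i => Re (f i)) n.
Proof. induction n as [|n IH]; [reflexivity|]. cbn [csum rsum]. rewrite <- IH. reflexivity. Qed.

Lemma Cmod2_plus p q : Cmod (Cplus p q) ^ 2 = Cmod p ^ 2 + Cmod q ^ 2 + 2 * Re (Cmult (Cconj p) q).
Proof. rewrite !Cmod2_alt. destruct p, q; simpl; ring. Qed.

Lemma parseval_poly c rho N n : 0 <= rho -> (n <= N)%nat ->
  rsum (fun j => Cmod (csum (fun i => Cmult (c i) (Cpow (circ_pt rho N j) i)) n) ^ 2) N =
  INR N * rsum (fun i => Cmod (c i) ^ 2 * (rho ^ 2) ^ i) n.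
Proof.
intros Hr. induction n as [|n IH]; intros Hn.
- simpl. rewrite Cmod_0. rewrite (rsum_ext _ (fun _ => 0 * 0)) by (intros; ring).
  rewrite rsum_scal; ring.
- cbn [csum rsum]. rewrite Rmult_plus_distr_l, <- IH by lia. clear IH.
  rewrite (rsum_ext _ (fun j =>
    Cmod (csum (fun i => Cmult (c i) (Cpow (circ_pt rho N j) i)) n) ^ 2 +
    (Cmod (c n) ^ 2 * (rho ^ 2) ^ n * 1 +
     2 * Re (Cmult (c n) (Cmult (Cconj (csum (fun i => Cmult (c i) (Cpow (circ_pt rho N j) i)) n))
        (Cpow (circ_pt rho N j) n)))))).
  2:{ intros j _. rewrite Cmod2_plus, Cmod_mult, Cmod_pow, Cmod_circ_pt by exact Hr.
      rewrite Rpow_mult_distr, <- !pow_mult, (Nat.mul_comm n 2).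
      rewrite Rmult_1_r, Rplus_assoc. do 3 f_equal. f_equal. ring. }
  rewrite !rsum_plus, !rsum_scal, <- Re_csum, csum_scal.
  replace (rsum (fun _ => 1) N) with (INR N).
  2:{ clear. induction N as [|N IH]; [reflexivity|]. rewrite S_INR, IH. reflexivity. }
  assert (Hcross : forall k, (k <= n)%nat ->
    csum (fun j => Cmult (Cconj (csum (fun i => Cmult (c i) (Cpow (circ_pt rho N j) i)) k))
        (Cpow (circ_pt rho N j) n)) N = RtoC 0).
  { induction k as [|k IHk]; intros Hk.
    - apply csum_zero. intros j _. cbn [csum]. rewrite Cconj_R. ring.
    - rewrite (csum_ext _ (fun j => Cplus
        (Cmult (Cconj (csum (fun i => Cmult (c i) (Cpow (circ_pt rho N j) i)) k)) (Cpow (circ_pt rho N j) n))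
        (Cmult (Cconj (c k)) (Cmult (Cconj (Cpow (circ_pt rho N j) k)) (Cpow (circ_pt rho N j) n))))).
      + rewrite csum_plus, csum_scal, IHk, circ_orthogonal by lia. ring.
      + intros j _. cbn [csum]. rewrite Cplus_conj, Cmult_conj. ring. }
  rewrite Hcross by lia. rewrite Cmult_0_r. simpl. ring.
Qed.

Lemma circ_mean_le rho N phi psi : 0 <= rho -> (0 < N)%nat ->
  (forall u, Cmod u = rho -> phi u <= psi u) -> circ_mean rho N phi <= circ_mean rho N psi.
Proof.
intros Hr HN H. apply Rmult_le_compat_l.
- apply Rlt_le, Rinv_0_lt_compat, lt_0_INR; exact HN.
- apply rsum_le; intros j _. apply H, Cmod_circ_pt, Hr.
Qed.

Lemma circ_mean_plus_const rho N phi B : (0 < N)%nat ->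
  circ_mean rho N (fun u => phi u + B) = circ_mean rho N phi + B.
Proof.
intros HN. assert (0 < INR N) by (apply lt_0_INR; exact HN). unfold circ_mean. rewrite rsum_plus.
rewrite (rsum_ext (fun _ => B) (fun _ => B * 1)) by (intros; ring). rewrite rsum_scal.
replace (rsum (fun _ => 1) N) with (INR N); [field; lra|].
clear. induction N as [|N IH]; [reflexivity|]. rewrite S_INR, IH. reflexivity.
Qed.

Lemma has_ps_abs2 c rho F x : has_ps c rho F -> 0 < x < rho ->
  ex_series (fun n => Cmod (c n) ^ 2 * (x ^ 2) ^ n).
Proof.
intros H Hx. pose proof (has_ps_abs c rho F x H ltac:(lra)) as Hex.
set (f := fun n => Cmod (c n) * x ^ n) in Hex.
assert (P : forall i, 0 <= f i)
  by (intros; apply Rmult_le_pos; [apply Cmod_ge_0|apply pow_le; lra]).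
apply (ex_series_le (K := R_AbsRing) (V := R_CompleteNormedModule) _ (fun n => Series f * f n)).
- intros n. change (Rabs (Cmod (c n) ^ 2 * (x ^ 2) ^ n) <= Series f * f n).
  rewrite Rabs_pos_eq by (apply Rmult_le_pos; [apply pow2_ge_0|apply pow_le, pow2_ge_0]).
  replace (Cmod (c n) ^ 2 * (x ^ 2) ^ n) with (f n * f n).
  2:{ unfold f. rewrite <- pow_mult, Nat.mul_comm, pow_mult. simpl. ring. }
  apply Rmult_le_compat_r; [apply P|].
  apply Rle_trans with (rsum f (S n)); [|apply rsum_le_Series; assumption].
  generalize (rsum_nonneg f n P); simpl; lra.
- apply (ex_series_scal_l (Series f) f). exact Hex.
Qed.

(** Replacing [F] by its Taylor polynomial of degree less than [N] costs a geometrically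
    small error, and for polynomials orthogonality makes the mean over the [N]-th roots exact. *)
Lemma parseval c R0 F rho : has_ps c R0 F -> 0 < rho < R0 ->
  is_lim_seq (fun N => circ_mean rho (S N) (fun u => Cmod (F u) ^ 2))
    (Series (fun n => Cmod (c n) ^ 2 * (rho ^ 2) ^ n)).
Proof.
intros H Hr. set (s := (rho + R0) / 2).
destruct (has_ps_tail c R0 F s H) as (S0 & HS0 & HT); [unfold s; lra|].
set (q := rho / s).
assert (Hq : 0 <= q < 1).
{ unfold q; split; [apply Rdiv_le_0_compat; unfold s; lra|]. apply Rlt_div_l; unfold s; lra. }
set (p := fun N u => csum (fun n => Cmult (c n) (Cpow u n)) N).
assert (Hclose : forall N u, Cmod u = rho ->
   Cmod (F u) ^ 2 <= Cmod (p N u) ^ 2 + 3 * S0 ^ 2 * q ^ N /\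
   Cmod (p N u) ^ 2 <= Cmod (F u) ^ 2 + 3 * S0 ^ 2 * q ^ N).
{ intros N u Hu. assert (Hus : Cmod u <= s) by (unfold s; lra).
  pose proof (HT N u Hus) as H1. pose proof (HT 0%nat u Hus) as H2. fold (p N u) in H1.
  rewrite Hu in H1. fold q in H1. simpl in H2.
  replace (Cminus (F u) (RtoC 0)) with (F u) in H2 by ring.
  assert (Hq1 : 0 <= q ^ N <= 1).
  { split; [apply pow_le; lra|rewrite <- (pow1 N); apply pow_incr; lra]. }
  generalize (Cmod_triangle_rev (F u) (p N u)) (Cmod_triangle_rev (p N u) (F u)).
  rewrite (Cmod_minus_sym (p N u)). intros.
  generalize (Cmod_ge_0 (F u)) (Cmod_ge_0 (p N u)); intros.
  assert (0 <= S0 * q ^ N <= S0) by nra.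
  split; nra. }
assert (Hmean : forall N, circ_mean rho (S N) (fun u => Cmod (p (S N) u) ^ 2) =
   rsum (fun n => Cmod (c n) ^ 2 * (rho ^ 2) ^ n) (S N)).
{ intros N. unfold circ_mean, p. rewrite parseval_poly by (lra || lia).
  field. apply not_0_INR; lia. }
set (L := Series _).
assert (HL : is_lim_seq (fun N => rsum (fun n => Cmod (c n) ^ 2 * (rho ^ 2) ^ n) (S N)) L).
{ apply (is_lim_seq_incr_1 (rsum (fun n => Cmod (c n) ^ 2 * (rho ^ 2) ^ n))).
  apply is_lim_seq_rsum, Series_correct. exact (has_ps_abs2 c R0 F rho H Hr). }
assert (HE : is_lim_seq (fun N => 3 * S0 ^ 2 * q ^ (S N)) 0).
{ apply (is_lim_seq_incr_1 (fun N => 3 * S0 ^ 2 * q ^ N)).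
  replace (Finite 0) with (Rbar_mult (3 * S0 ^ 2) 0) by (simpl; f_equal; ring).
  apply is_lim_seq_scal_l, is_lim_seq_geom. rewrite Rabs_pos_eq; lra. }
apply is_lim_seq_le_le with
  (fun N => rsum (fun n => Cmod (c n) ^ 2 * (rho ^ 2) ^ n) (S N) - 3 * S0 ^ 2 * q ^ (S N))
  (fun N => rsum (fun n => Cmod (c n) ^ 2 * (rho ^ 2) ^ n) (S N) + 3 * S0 ^ 2 * q ^ (S N)).
- intros N. rewrite <- Hmean.
  generalize (circ_mean_le rho (S N) (fun u => Cmod (F u) ^ 2)
     (fun u => Cmod (p (S N) u) ^ 2 + 3 * S0 ^ 2 * q ^ (S N)) ltac:(lra) ltac:(lia)
     (fun u Hu => proj1 (Hclose (S N) u Hu)))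
   (circ_mean_le rho (S N) (fun u => Cmod (p (S N) u) ^ 2)
     (fun u => Cmod (F u) ^ 2 + 3 * S0 ^ 2 * q ^ (S N)) ltac:(lra) ltac:(lia)
     (fun u Hu => proj2 (Hclose (S N) u Hu))).
  rewrite !circ_mean_plus_const by lia. lra.
- replace L with (L - 0) by ring. apply is_lim_seq_minus'; assumption.
- replace L with (L + 0) by ring. apply is_lim_seq_plus'; assumption.
Qed.

Lemma parseval_le c d R0 F G rho : has_ps c R0 F -> has_ps d R0 G -> 0 < rho < R0 ->
  (forall u, Cmod u = rho -> Cmod (F u) <= Cmod (G u)) ->
  Series (fun n => Cmod (c n) ^ 2 * (rho ^ 2) ^ n) <= Series (fun n => Cmod (d n) ^ 2 * (rho ^ 2) ^ n).
Proof.
intros HF HG Hr Hle.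
apply (is_lim_seq_le (fun N => circ_mean rho (S N) (fun u => Cmod (F u) ^ 2))
  (fun N => circ_mean rho (S N) (fun u => Cmod (G u) ^ 2))
  (Series (fun n => Cmod (c n) ^ 2 * (rho ^ 2) ^ n)) (Series (fun n => Cmod (d n) ^ 2 * (rho ^ 2) ^ n))).
- intros N. apply circ_mean_le; [lra|lia|]. intros u Hu.
  apply pow_incr. split; [apply Cmod_ge_0|auto].
- exact (parseval c R0 F rho HF Hr).
- exact (parseval d R0 G rho HG Hr).
Qed.

(** * Coefficients of bounded and of quasiconformal mappings *)

Lemma has_ps_shift_iter n c rho F : has_ps c rho F ->
  has_ps (Nat.iter n coeff_shift c) rho (fun u => Cmult (Cpow u n) (F u)).
Proof.
intros H. induction n as [|n IH].
- apply has_ps_ext with (2 := H). intros u _; simpl; ring.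
- apply has_ps_mul_id in IH. apply has_ps_ext with (2 := IH). intros u _. rewrite Cpow_S; ring.
Qed.

Lemma coeff_shift_iter_lt n c i : (i < n)%nat -> Nat.iter n coeff_shift c i = RtoC 0.
Proof.
revert i; induction n as [|n IH]; intros i Hi; [lia|].
destruct i as [|i]; [reflexivity|]. simpl. apply IH; lia.
Qed.

Lemma coeff_shift_iter_ge n c i : Nat.iter n coeff_shift c (n + i)%nat = c i.
Proof. induction n as [|n IH]; [reflexivity|]. exact IH. Qed.

Lemma Series_two f n : (1 <= n)%nat -> (forall i, i <> O -> i <> n -> f i = 0) ->
  Series f = f O + f n.
Proof.
intros Hn H. apply is_series_unique.
assert (HS : forall N, (n <= N)%nat -> rsum f (S N) = f O + f n).
{ intros N HN. induction HN as [|N HN IH].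
  - cbn [rsum]. f_equal. destruct n as [|n]; [lia|]. rewrite rsum_S_l.
    rewrite (rsum_ext _ (fun i => 0 * 0)).
    + rewrite rsum_scal; ring.
    + intros i Hi. rewrite H by lia. ring.
  - cbn [rsum] in *. rewrite IH, (H (S N)) by lia. ring. }
apply (is_lim_seq_ext_loc (fun _ => f O + f n) (sum_n f) (f O + f n)).
- exists n; intros N HN; rewrite rsum_sum_n; symmetry; apply HS, HN.
- apply is_lim_seq_const.
Qed.

(** Multiplication by [h] does not increase the mean square of [1 + beta u^n]; the two
    coefficients 0 and [n] of the product, for the best [beta], give the bound. *)
Lemma bounded_coeff_le a h n : has_ps a 1 h -> (forall z, Cmod z < 1 -> Cmod (h z) <= 1) ->
  Cmod (a O) < 1 -> (1 <= n)%nat -> Cmod (a n) <= 1 - Cmod (a O) ^ 2.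
Proof.
intros H Hle HA Hn. set (A := Cmod (a O)) in *.
assert (HA0 : 0 <= A) by apply Cmod_ge_0.
assert (HA1 : 0 < 1 - A ^ 2) by nra.
destruct (polar (a n)) as (v & Hv & Ev).
enough (HQ : forall rho, 0 < rho < 1 -> Cmod (a n) * rho ^ n <= 1 - A ^ 2).
{ set (phi := fun rho => 1 - A ^ 2 + Cmod (a n) * (1 - rho ^ n)).
  replace (1 - A ^ 2) with (phi 1) by (unfold phi; rewrite pow1; ring).
  apply (le_limit_at_1 phi _ 0); [lra| |].
  - apply ex_derive_continuity_pt.
    unfold phi; auto_derive. exact I.
  - intros r Hr. specialize (HQ r Hr). unfold phi. lra. }
intros rho Hr.
set (y := rho ^ n). assert (Hy : 0 < y) by (apply pow_lt; lra).
set (q := Cmod (a n) * y).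
assert (Hq : 0 <= q) by (apply Rmult_le_pos; [apply Cmod_ge_0|lra]).
(* beta turns beta a_0 into the direction of a_n, and its size t / y * A gives the strongest
   inequality between the mean squares *)
set (t := q / (1 - A ^ 2)).
set (beta := Cmult (RtoC (t / y)) (Cmult (Cconj (a O)) v)).
set (cF := fun i => Cplus (Cmult (RtoC 1) (a i)) (Cmult beta (Nat.iter n coeff_shift a i))).
set (cG := fun i => Cplus (Cmult (RtoC 1) (coeff_const 1 i))
   (Cmult beta (Nat.iter n coeff_shift (coeff_const 1) i))).
assert (HF : has_ps cF 1 (fun u => Cmult (h u) (Cplus (RtoC 1) (Cmult beta (Cpow u n))))).
{ apply has_ps_ext with (fun u => Cplus (Cmult (RtoC 1) (h u)) (Cmult beta (Cmult (Cpow u n) (h u))));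
    [intros u _; ring|].
  apply has_ps_lin; [|apply has_ps_shift_iter]; exact H. }
assert (HG : has_ps cG 1 (fun u => Cplus (RtoC 1) (Cmult beta (Cpow u n)))).
{ apply has_ps_ext with (fun u => Cplus (Cmult (RtoC 1) (RtoC 1)) (Cmult beta (Cmult (Cpow u n) (RtoC 1))));
    [intros u _; ring|].
  apply (has_ps_lin (RtoC 1) beta (coeff_const 1) _ 1 (fun _ => RtoC 1) (fun u => Cmult (Cpow u n) (RtoC 1)));
    [apply has_ps_const|apply (has_ps_shift_iter n (coeff_const 1) 1 (fun _ => RtoC 1)), has_ps_const]. }
pose proof (parseval_le _ _ 1 _ _ rho HF HG Hr) as HP.
assert (HP' : Series (fun n0 => Cmod (cF n0) ^ 2 * (rho ^ 2) ^ n0) <=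
   Series (fun n0 => Cmod (cG n0) ^ 2 * (rho ^ 2) ^ n0)).
{ apply HP. intros u Hu. rewrite Cmod_mult. rewrite <- Rmult_1_l.
  apply Rmult_le_compat_r; [apply Cmod_ge_0|apply Hle; lra]. }
clear HP.
assert (EF0 : cF O = a O).
{ unfold cF. rewrite coeff_shift_iter_lt by lia. ring. }
assert (EFn : cF n = Cplus (a n) (Cmult beta (a O))).
{ unfold cF. generalize (coeff_shift_iter_ge n a 0). rewrite Nat.add_0_r. intros ->. ring. }
assert (EG0 : cG O = RtoC 1).
{ unfold cG. rewrite coeff_shift_iter_lt by lia. simpl. ring. }
assert (EGn : cG n = beta).
{ unfold cG. generalize (coeff_shift_iter_ge n (coeff_const 1) 0). rewrite Nat.add_0_r. intros ->.
  destruct n; [lia|]. simpl. ring. }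
assert (EGi : forall i, i <> O -> i <> n -> cG i = RtoC 0).
{ intros i Hi Hin. unfold cG. replace (coeff_const 1 i) with (RtoC 0) by (destruct i; [congruence|reflexivity]).
  destruct (Compare_dec.le_lt_dec n i) as [Hge|Hlt].
  - replace i with (n + S (i - n - 1))%nat by lia. rewrite coeff_shift_iter_ge. simpl. ring.
  - rewrite coeff_shift_iter_lt by exact Hlt. ring. }
rewrite (Series_two (fun n0 => Cmod (cG n0) ^ 2 * (rho ^ 2) ^ n0) n) in HP'.
2: exact Hn. 2:{ intros i Hi Hin. rewrite EGi by assumption. rewrite Cmod_0. ring. }
assert (HPF : Cmod (cF O) ^ 2 * (rho ^ 2) ^ O + Cmod (cF n) ^ 2 * (rho ^ 2) ^ n <=
   Series (fun n0 => Cmod (cF n0) ^ 2 * (rho ^ 2) ^ n0)).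
{ set (f := fun n0 => Cmod (cF n0) ^ 2 * (rho ^ 2) ^ n0).
  assert (Pf : forall i, 0 <= f i) by (intros i; apply Rmult_le_pos; [apply pow2_ge_0|apply pow_le, pow2_ge_0]).
  apply Rle_trans with (rsum f (S n)); [|apply rsum_le_Series; [exact Pf|exact (has_ps_abs2 _ _ _ _ HF Hr)]].
  destruct n as [|n]; [lia|]. change (f O + f (S n) <= rsum f (S (S n))).
  rewrite rsum_S_l. cbn [rsum].
  generalize (rsum_nonneg (fun i => f (S i)) n (fun i => Pf (S i))). lra. }
pose proof (Rle_trans _ _ _ HPF HP') as HH. clear HPF HP'.
rewrite EF0, EFn, EG0, EGn, Cmod_1 in HH. fold A in HH.
replace ((rho ^ 2) ^ n) with (y ^ 2) in HH
  by (unfold y; rewrite <- !pow_mult; f_equal; lia).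
assert (Et : 0 <= t) by (apply Rdiv_le_0_compat; assumption).
assert (Eb : Cmod beta = t / y * A).
{ unfold beta. rewrite !Cmod_mult, Cmod_conj, Hv, Cmod_R, Rabs_pos_eq; [fold A; ring|].
  apply Rdiv_le_0_compat; assumption. }
assert (Es : Cmod (Cplus (a n) (Cmult beta (a O))) = Cmod (a n) + t / y * A ^ 2).
{ replace (Cplus (a n) (Cmult beta (a O))) with (Cmult (RtoC (Cmod (a n) + t / y * A ^ 2)) v).
  - rewrite Cmod_mult, Hv, Cmod_R, Rabs_pos_eq; [ring|].
    apply Rplus_le_le_0_compat; [apply Cmod_ge_0|].
    apply Rmult_le_pos; [apply Rdiv_le_0_compat; assumption|apply pow2_ge_0].
  - rewrite Ev at 2. unfold beta. rewrite RtoC_plus, RtoC_mult. unfold A. rewrite Cmod2_conj. ring. }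
rewrite Es, Eb in HH.
assert (HH' : A ^ 2 + (q + t * A ^ 2) ^ 2 <= 1 + t ^ 2 * A ^ 2).
{ replace (q + t * A ^ 2) with ((Cmod (a n) + t / y * A ^ 2) * y) by (unfold q; field; lra).
  replace (t ^ 2 * A ^ 2) with ((t / y * A) ^ 2 * y ^ 2) by (field; lra).
  rewrite Rpow_mult_distr. simpl in HH |- *. lra. }
assert (Eq : q = t * (1 - A ^ 2)) by (unfold t; field; lra).
replace (q + t * A ^ 2) with t in HH' by (rewrite Eq; ring).
assert (Ht1 : t <= 1); [|rewrite Eq; nra].
apply Rnot_lt_le; intros Ht1. nra.
Qed.

(** Each application undoes one differentiation, that is, one factor [n] in the coefficients. *)
Lemma PSeries_ge_of_derive e :
  (forall s, 0 <= s < 1 -> Rbar_lt s (CV_radius e)) ->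
  (forall x, 0 < x < 1 -> 0 <= PSeries (PS_derive e) x) ->
  forall x, 0 < x < 1 -> e O <= PSeries e x.
Proof.
intros HR H x Hx.
destruct (MVT_cor2 (PSeries e) (PSeries (PS_derive e)) 0 x) as (c & Hc & Hcx); [lra| |].
- intros c Hc. apply is_derive_Reals, is_derive_PSeries.
  rewrite Rabs_pos_eq by lra. apply HR; lra.
- rewrite PSeries_0 in Hc. specialize (H c ltac:(lra)). nra.
Qed.

(** Constant terms are discarded because the hypothesis compares derivatives. *)
Definition coeff_gap (k : R) (a b : nat -> C) (n : nat) : R :=
  match n with O => 0 | S _ => k ^ 2 * Cmod (a n) ^ 2 - Cmod (b n) ^ 2 end.

Lemma coeff_gap_radius k a b h g : has_ps a 1 h -> has_ps b 1 g ->
  forall s, 0 <= s < 1 -> Rbar_lt s (CV_radius (coeff_gap k a b)).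
Proof.
intros Ha Hb s Hs. set (x := (s + 1) / 2).
assert (Hx : 0 < x < 1) by (unfold x; lra).
apply Rbar_lt_le_trans with x; [simpl; unfold x; lra|].
apply (CV_radius_bounded (coeff_gap k a b)).
assert (Hr : 0 < sqrt x < 1).
{ split; [apply sqrt_lt_R0; lra|]. rewrite <- sqrt_1. apply sqrt_lt_1; lra. }
assert (B : forall c F, has_ps c 1 F -> exists M, forall n, Cmod (c n) ^ 2 * x ^ n <= M).
{ intros c F Hc. exists (Series (fun n => Cmod (c n) ^ 2 * (sqrt x ^ 2) ^ n)). intros n.
  rewrite <- (pow2_sqrt x) at 1 by lra.
  set (f := fun n => Cmod (c n) ^ 2 * (sqrt x ^ 2) ^ n).
  assert (Pf : forall i, 0 <= f i) by (intros i; apply Rmult_le_pos; [apply pow2_ge_0|apply pow_le, pow2_ge_0]).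
  change (f n <= Series f).
  apply Rle_trans with (rsum f (S n)); [|apply rsum_le_Series; [exact Pf|exact (has_ps_abs2 _ _ _ _ Hc Hr)]].
  generalize (rsum_nonneg f n Pf). simpl; lra. }
destruct (B a h Ha) as [Ma HMa]. destruct (B b g Hb) as [Mb HMb].
exists (k ^ 2 * Ma + Mb). intros n.
assert (Hxn : 0 <= x ^ n) by (apply pow_le; lra).
assert (Ba : 0 <= Cmod (a n) ^ 2 * x ^ n) by (apply Rmult_le_pos; [apply pow2_ge_0|exact Hxn]).
assert (Bb : 0 <= Cmod (b n) ^ 2 * x ^ n) by (apply Rmult_le_pos; [apply pow2_ge_0|exact Hxn]).
specialize (HMa n); specialize (HMb n). generalize (pow2_ge_0 k); intros Hk.
assert (k ^ 2 * (Cmod (a n) ^ 2 * x ^ n) <= k ^ 2 * Ma) by (apply Rmult_le_compat_l; assumption).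
assert (0 <= k ^ 2 * (Cmod (a n) ^ 2 * x ^ n)) by (apply Rmult_le_pos; assumption).
apply Rabs_le. destruct n as [|n]; simpl coeff_gap; [lra|].
replace ((k ^ 2 * Cmod (a (S n)) ^ 2 - Cmod (b (S n)) ^ 2) * x ^ S n) with
  (k ^ 2 * (Cmod (a (S n)) ^ 2 * x ^ S n) - Cmod (b (S n)) ^ 2 * x ^ S n) by ring.
lra.
Qed.

(** Parseval for [g'] and [h'] gives the inequality with an extra factor [n^2];
    integrating the real power series twice against [dx/x] removes it. *)
Lemma dilatation_PSeries k a b h g : 0 <= k -> has_ps a 1 h -> has_ps b 1 g ->
  (forall z, Cmod z < 1 -> Cmod (C_derive g z) <= k * Cmod (C_derive h z)) ->
  forall x, 0 < x < 1 -> 0 <= PSeries (coeff_gap k a b) x.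
Proof.
intros Hk Ha Hb Hgh.
pose proof (coeff_gap_radius k a b h g Ha Hb) as HR.
set (d := coeff_gap k a b) in *.
assert (HR1 : forall s, 0 <= s < 1 -> Rbar_lt s (CV_radius (PS_incr_1 (PS_derive d)))).
{ intros s Hs. rewrite CV_radius_incr_1, CV_radius_derive. auto. }
apply (PSeries_ge_of_derive d HR). intros x Hx.
enough (H : 0 <= PSeries (PS_incr_1 (PS_derive d)) x).
{ rewrite PSeries_incr_1 in H. nra. }
apply (PSeries_ge_of_derive _ HR1); [|exact Hx]. clear x Hx. intros x Hx.
set (rho := sqrt x).
assert (Hr : 0 < rho < 1).
{ split; [apply sqrt_lt_R0; lra|]. unfold rho. rewrite <- sqrt_1. apply sqrt_lt_1; lra. }
assert (Er : rho ^ 2 = x) by (apply pow2_sqrt; lra).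
assert (HF := has_ps_derive _ _ _ Hb).
assert (HG := has_ps_derive _ _ _ Ha).
apply (has_ps_lin (RtoC k) (RtoC 0) _ _ _ _ _ HG) in HG.
pose proof (parseval_le _ _ 1 _ _ rho HF HG Hr) as HP. cbv beta in HP.
assert (HP' := HP ltac:(intros u Hu;
  replace (Cplus (Cmult (RtoC k) (C_derive h u)) (Cmult (RtoC 0) (C_derive h u)))
    with (Cmult (RtoC k) (C_derive h u)) by ring;
  rewrite Cmod_mult, Cmod_R, Rabs_pos_eq by exact Hk; apply Hgh; lra)). clear HP.
pose proof (has_ps_abs2 _ _ _ _ HF Hr) as EF. pose proof (has_ps_abs2 _ _ _ _ HG Hr) as EG.
apply Rle_minus in HP'.
rewrite <- Series_minus in HP' by assumption.
replace (PSeries (PS_derive (PS_incr_1 (PS_derive d))) x) with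
  (- Series (fun n => Cmod (coeff_derive b n) ^ 2 * (rho ^ 2) ^ n -
     Cmod (Cplus (Cmult (RtoC k) (coeff_derive a n)) (Cmult (RtoC 0) (coeff_derive a n))) ^ 2 * (rho ^ 2) ^ n)).
{ lra. }
rewrite <- Series_opp. apply Series_ext. intros n. rewrite Er.
replace (Cplus (Cmult (RtoC k) (coeff_derive a n)) (Cmult (RtoC 0) (coeff_derive a n)))
  with (Cmult (RtoC k) (coeff_derive a n)) by ring.
unfold coeff_derive, PS_derive, PS_incr_1. rewrite !Cmod_mult, !Cmod_R, !Rabs_pos_eq by (exact Hk || apply pos_INR).
unfold d, coeff_gap. ring.
Qed.

(** Sum [2 M u <= u^2 + M^2] with the weights [w]. As [M] may vanish, it is first enlarged
    by a small positive amount. *)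
Lemma rsum_weighted_le w u X M n : (forall i, 0 <= w i) -> 0 <= M ->
  rsum w n <= X -> rsum (fun i => u i ^ 2 * w i) n <= M ^ 2 * X -> rsum (fun i => u i * w i) n <= M * X.
Proof.
intros Hw HM HX H.
assert (HX0 : 0 <= X) by (apply Rle_trans with (rsum w n); [apply rsum_nonneg, Hw|exact HX]).
apply le_epsilon; intros eps He.
set (M' := M + eps / (X + 1)).
assert (He' : 0 < eps / (X + 1)) by (apply Rdiv_lt_0_compat; lra).
assert (HM' : 0 < M') by (unfold M'; lra).
apply Rle_trans with (M' * X).
- apply Rmult_le_reg_l with (2 * M'); [lra|].
  rewrite <- rsum_scal.
  apply Rle_trans with (rsum (fun i => u i ^ 2 * w i + M' ^ 2 * w i) n).
  + apply rsum_le; intros i _. specialize (Hw i). generalize (pow2_ge_0 (u i - M')); intros; nra.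
  + rewrite rsum_plus, rsum_scal.
    assert (M ^ 2 * X <= M' ^ 2 * X).
    { apply Rmult_le_compat_r; [exact HX0|]. apply pow_incr; unfold M'; lra. }
    assert (M' ^ 2 * rsum w n <= M' ^ 2 * X) by (apply Rmult_le_compat_l; [apply pow2_ge_0|exact HX]).
    lra.
- unfold M'. assert (eps / (X + 1) * X <= eps).
  { replace (eps / (X + 1) * X) with (eps * (X / (X + 1))) by (field; lra).
    rewrite <- (Rmult_1_r eps) at 2. apply Rmult_le_compat_l; [lra|].
    apply Rle_div_l; lra. }
  lra.
Qed.

Lemma rsum_geom_le x n : 0 <= x < 1 -> rsum (fun i => x ^ (S i)) n <= x / (1 - x).
Proof.
intros Hx.
assert (E : rsum (fun i => x ^ (S i)) n = x * (1 - x ^ n) / (1 - x)).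
{ induction n as [|n IH]; [simpl; field; lra|]. cbn [rsum]. rewrite IH. simpl. field. lra. }
rewrite E. apply Rmult_le_compat_r; [apply Rlt_le, Rinv_0_lt_compat; lra|].
assert (0 <= x ^ n) by (apply pow_le; lra). nra.
Qed.

(** A single [|b_n|] may exceed [k |a_n|]: only the weighted square sums are comparable,
    and the passage to first powers costs nothing because all [|a_n|] share the bound [B]. *)
Lemma dilatation_coeff_sum k a b h g B : 0 <= k -> 0 <= B -> has_ps a 1 h -> has_ps b 1 g ->
  (forall z, Cmod z < 1 -> Cmod (C_derive g z) <= k * Cmod (C_derive h z)) ->
  (forall n, (1 <= n)%nat -> Cmod (a n) <= B) ->
  forall x n, 0 < x < 1 -> rsum (fun i => Cmod (b (S i)) * x ^ (S i)) n <= k * B * (x / (1 - x)).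
Proof.
intros Hk HB Ha Hb Hgh HaB x n Hx.
apply rsum_weighted_le.
- intros i; apply pow_le; lra.
- apply Rmult_le_pos; assumption.
- apply rsum_geom_le; lra.
- set (d := coeff_gap k a b).
  pose proof (dilatation_PSeries k a b h g Hk Ha Hb Hgh x Hx) as HP.
  assert (Hex : ex_series (fun i => d i * x ^ i)).
  { apply ex_series_Rabs. apply CV_disk_inside. rewrite Rabs_pos_eq by lra.
    apply (coeff_gap_radius k a b h g Ha Hb); lra. }
  (* the partial sums of the gap converge to a nonnegative limit, and each is at most
     the bound for the [a]-part minus the increasing [b]-part *)
  assert (Hlim : is_lim_seq (rsum (fun i => d i * x ^ i)) (PSeries d x)).
  { apply is_lim_seq_rsum, Series_correct, Hex. }
  set (U := rsum (fun i => Cmod (b (S i)) ^ 2 * x ^ S i) n).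
  assert (Hup : forall N, (S n <= N)%nat -> rsum (fun i => d i * x ^ i) N <= (k * B) ^ 2 * (x / (1 - x)) - U).
  { intros [|N] HN; [lia|]. rewrite rsum_S_l. unfold d at 1. simpl coeff_gap. rewrite Rmult_0_l, Rplus_0_l.
    assert (HU : U <= rsum (fun i => Cmod (b (S i)) ^ 2 * x ^ S i) N).
    { apply rsum_mono; [|lia]. intros i; apply Rmult_le_pos; [apply pow2_ge_0|apply pow_le; lra]. }
    assert (HA : rsum (fun i => d (S i) * x ^ S i + Cmod (b (S i)) ^ 2 * x ^ S i) N <=
       (k * B) ^ 2 * (x / (1 - x))).
    { apply Rle_trans with ((k * B) ^ 2 * rsum (fun i => x ^ S i) N).
      - rewrite <- rsum_scal. apply rsum_le; intros i _. unfold d, coeff_gap.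
        apply Rle_trans with ((k * Cmod (a (S i))) ^ 2 * x ^ S i); [right; ring|].
        apply Rmult_le_compat_r; [apply pow_le; lra|].
        apply pow_incr; split; [apply Rmult_le_pos; [exact Hk|apply Cmod_ge_0]|].
        apply Rmult_le_compat_l; [exact Hk|apply HaB; lia].
      - apply Rmult_le_compat_l; [apply pow2_ge_0|apply rsum_geom_le; lra]. }
    rewrite rsum_plus in HA. lra. }
  assert (HL : Rbar_le (PSeries d x) ((k * B) ^ 2 * (x / (1 - x)) - U)).
  { apply (is_lim_seq_le_loc (rsum (fun i => d i * x ^ i)) (fun _ => (k * B) ^ 2 * (x / (1 - x)) - U));
      [exists (S n); exact Hup|exact Hlim|apply is_lim_seq_const]. }
  simpl in HL. fold d in HP. lra.
Qed.

(** * The radius *)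

Lemma pow_lt_mono x y n : 0 <= x < y -> (1 <= n)%nat -> x ^ n < y ^ n.
Proof.
intros Hxy Hn. induction Hn as [|n Hn IH]; [simpl; lra|].
simpl. apply Rle_lt_trans with (x * y ^ n).
- apply Rmult_le_compat_l; lra.
- apply Rmult_lt_compat_r; [apply pow_lt|]; lra.
Qed.

Lemma pow_unit_interval x n : 0 <= x < 1 -> (1 <= n)%nat -> 0 <= x ^ n < 1.
Proof.
intros Hx Hn; split; [apply pow_le; lra|]. rewrite <- (pow1 n). apply pow_lt_mono; [lra|exact Hn].
Qed.

Definition radius_num (m q : nat) (x : R) : R := 1 - x ^ (2 * m) - x ^ q.

Lemma radius_num_decr m q x y : (1 <= m)%nat -> (1 <= q)%nat -> 0 <= x < y ->
  radius_num m q y < radius_num m q x.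
Proof.
intros Hm Hq Hxy. unfold radius_num.
generalize (pow_lt_mono x y (2 * m) Hxy ltac:(lia)) (pow_lt_mono x y q Hxy Hq). lra.
Qed.

Lemma R2_exists m q : (1 <= m)%nat -> (1 <= q)%nat -> exists R2, is_R2 m q R2.
Proof.
intros Hm Hq.
destruct (IVT (fun x => - radius_num m q x) 0 1) as (R2 & HR2 & E).
- intros x. apply ex_derive_continuity_pt.
  unfold radius_num; auto_derive; exact I.
- lra.
- unfold radius_num. rewrite !pow_i by lia. lra.
- unfold radius_num. rewrite !pow1. lra.
- assert (E' : radius_num m q R2 = 0) by lra.
  exists R2. split.
  + split; [|exact E'].
    assert (R2 <> 0) by (intros ->; unfold radius_num in E'; rewrite !pow_i in E' by lia; lra).
    assert (R2 <> 1) by (intros ->; unfold radius_num in E'; rewrite !pow1 in E'; lra).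
    lra.
  + intros x [Hx Ex]. fold (radius_num m q x) in Ex.
    destruct (Rtotal_order R2 x) as [H|[H|H]]; [|exact H|].
    * generalize (radius_num_decr m q R2 x Hm Hq ltac:(lra)); lra.
    * generalize (radius_num_decr m q x R2 Hm Hq ltac:(lra)); lra.
Qed.

(** Where the numerator is nonnegative both summands of [radius_fun] increase. *)
Lemma radius_fun_incr m p q k x y : (1 <= m)%nat -> (1 <= p)%nat -> (1 <= q)%nat -> 0 <= k ->
  0 <= x < y -> y < 1 -> 0 <= radius_num m q x -> radius_fun m p q k x < radius_fun m p q k y.
Proof.
intros Hm Hp Hq Hk Hxy Hy Hn. unfold radius_fun.
fold (radius_num m q x). fold (radius_num m q y).
pose proof (radius_num_decr m q x y Hm Hq Hxy) as Hd.
pose proof (pow_lt_mono x y m Hxy Hm) as H1.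
pose proof (pow_lt_mono x y p Hxy Hp) as H2.
pose proof (pow_unit_interval y p ltac:(lra) Hp) as H3.
assert (H4 : 0 <= x ^ m) by (apply pow_le; lra).
assert (H5 : 0 <= x ^ p) by (apply pow_le; lra).
assert (A : radius_num m q y / (1 + y ^ m) ^ 2 <= radius_num m q x / (1 + x ^ m) ^ 2).
{ apply Rle_trans with (radius_num m q x / (1 + y ^ m) ^ 2).
  - apply Rmult_le_compat_r; [|lra]. apply Rlt_le, Rinv_0_lt_compat, pow_lt; lra.
  - apply Rmult_le_compat_l; [exact Hn|]. apply Rinv_le_contravar; [apply pow_lt; lra|].
    apply pow_incr; lra. }
assert (B : (x ^ p + k) * x ^ p / (1 - x ^ p) < (y ^ p + k) * y ^ p / (1 - y ^ p)).
{ apply Rle_lt_trans with ((x ^ p + k) * x ^ p / (1 - y ^ p)).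
  - apply Rmult_le_compat_l; [nra|]. apply Rinv_le_contravar; lra.
  - apply Rmult_lt_compat_r; [apply Rinv_0_lt_compat; lra|nra]. }
lra.
Qed.

Lemma radius_exists m p q k R2 : (1 <= m)%nat -> (1 <= p)%nat -> (1 <= q)%nat -> 0 <= k ->
  is_R2 m q R2 -> exists r, is_radius m p q k r /\ r <= R2.
Proof.
intros Hm Hp Hq Hk [[HR2 E] _]. fold (radius_num m q R2) in E.
destruct (IVT_interv (radius_fun m p q k) 0 R2) as (r & Hr & Er).
- intros x Hx. apply ex_derive_continuity_pt.
  unfold radius_fun; auto_derive.
  assert (0 <= x ^ m) by (apply pow_le; lra).
  generalize (pow_unit_interval x p ltac:(lra) Hp); intros.
  repeat split; try lra. apply Rgt_not_eq; nra.
- lra.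
- unfold radius_fun. rewrite !pow_i by lia. unfold Rdiv.
  rewrite Rmult_0_r, Rmult_0_l. replace ((1 + 0) ^ 2) with 1 by ring. lra.
- unfold radius_fun. fold (radius_num m q R2). rewrite E.
  generalize (pow_unit_interval R2 p ltac:(lra) Hp); intros.
  assert (0 < R2 ^ p) by (apply pow_lt; lra).
  unfold Rdiv at 1. rewrite Rmult_0_l, Ropp_0, Rplus_0_l.
  apply Rdiv_lt_0_compat; [nra|lra].
- assert (Hr0 : r <> 0).
  { intros ->. unfold radius_fun in Er. rewrite !pow_i in Er by lia. unfold Rdiv in Er.
    rewrite Rmult_0_r, Rmult_0_l in Er. replace ((1 + 0) ^ 2) with 1 in Er by ring. lra. }
  exists r. split; [|lra]. split; [lra|]. split; [exact Er|].
  intros s Hs Es. apply Rnot_lt_le. intros Hsr.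
  assert (Hns : 0 <= radius_num m q s).
  { rewrite <- E. apply Rlt_le, radius_num_decr; try assumption; lra. }
  generalize (radius_fun_incr m p q k s r Hm Hp Hq Hk ltac:(lra) ltac:(lra) Hns). lra.
Qed.

Lemma kappa_bounds K : 1 <= K -> 0 <= kappa K < 1.
Proof.
intros HK; unfold kappa; split; [apply Rdiv_le_0_compat; lra|apply Rlt_div_l; lra].
Qed.

(** * The inequality *)

Lemma abs_sum_le N c x M : (forall n, rsum (fun i => Cmod (c (N + i)%nat) * x ^ (N + i)) n <= M) ->
  Rbar_le (abs_sum N c x) M.
Proof.
intros H. unfold abs_sum. rewrite <- (Lim_seq_const M). apply Lim_seq_le_loc.
exists O; intros n _. rewrite rsum_sum_n. apply H.
Qed.

(** Here [X = 1 - |h|^2] and [D = |h'|] at the point of modulus [rho], and [A = |a_0|].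
    The bound on [D] leaves [X (1 - rho^2 - s) / (1 - rho^2)] of [X], the other bound on [X]
    compares this with [1 - A^2], and the equation for [r] says that the remaining factor
    is exactly what the coefficient sums consume. *)
Lemma bohr_real_inequality k r m p q A X D rho s :
  0 <= A < 1 -> 0 <= rho < 1 -> 0 <= s -> 0 <= D -> 0 <= X ->
  rho <= r ^ m -> s <= r ^ q -> 0 <= r ^ m < 1 ->
  0 <= radius_num m q r -> radius_fun m p q k r = 0 ->
  D * (1 - rho ^ 2) <= X -> (1 - A ^ 2) * (1 - rho ^ 2) <= X * (1 + A * rho) ^ 2 ->
  D * s + (1 - A ^ 2) * ((r ^ p + k) * r ^ p / (1 - r ^ p)) <= X.
Proof.
intros HA Hrho Hs HD HX Hrm Hsq Hrm1 Hnum Hrad HDX HAX.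
unfold radius_fun in Hrad. fold (radius_num m q r) in Hrad.
replace ((r ^ p + k) * r ^ p / (1 - r ^ p)) with (radius_num m q r / (1 + r ^ m) ^ 2) by lra.
set (Phi := radius_num m q r) in *. set (y := r ^ m) in *.
assert (HPhi : Phi <= 1 - rho ^ 2 - s).
{ assert (rho ^ 2 <= y ^ 2) by (apply pow_incr; lra).
  unfold Phi, radius_num. replace (r ^ (2 * m)) with (y ^ 2); [lra|].
  unfold y. rewrite <- pow_mult, Nat.mul_comm. reflexivity. }
set (c := 1 - rho ^ 2) in *. assert (Hc : 0 < c) by (unfold c; nra).
assert (HA2 : 0 < 1 - A ^ 2) by nra.
assert (H1 : (1 - A ^ 2) * c <= X * (1 + y) ^ 2).
{ apply Rle_trans with (1 := HAX). apply Rmult_le_compat_l; [exact HX|].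
  apply pow_incr; nra. }
assert (Hy2 : 0 < (1 + y) ^ 2) by (apply pow_lt; lra).
assert (H2 : (1 - A ^ 2) * (Phi / (1 + y) ^ 2) * c <= X * Phi).
{ replace ((1 - A ^ 2) * (Phi / (1 + y) ^ 2) * c) with ((1 - A ^ 2) * c / (1 + y) ^ 2 * Phi) by (field; lra).
  apply Rmult_le_compat_r; [exact Hnum|]. apply Rle_div_l; lra. }
apply Rmult_le_reg_r with c; [exact Hc|].
rewrite Rmult_plus_distr_r.
assert (D * s * c <= X * s) by (replace (D * s * c) with (D * c * s) by ring; apply Rmult_le_compat_r; assumption).
assert (X * Phi <= X * (c - s)) by (apply Rmult_le_compat_l; [exact HX|lra]).
lra.
Qed.

Lemma admissible_bohr_le K m p q f h g a b w r z :
  1 <= K -> (1 <= m)%nat -> (1 <= p)%nat -> (1 <= q)%nat ->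
  0 < r < 1 -> radius_fun m p q (kappa K) r = 0 -> 0 <= radius_num m q r ->
  admissible K f h g a b w -> Cmod z <= r ->
  Rbar_le (bohr_sum m p q h a b w z) 1.
Proof.
intros HK Hm Hp Hq Hr Hrad Hnum [[[Hh [Hg _]] [Hlu Hqc]] [Ea [Eb [Hsup Hw]]]] Hz.
rewrite analytic_on_disc_at in Hh. rewrite sup_norm_le_1 in Hsup.
pose proof (kappa_bounds K HK) as Hk. set (k := kappa K) in *. clearbody k.
assert (H0 : Cmod (RtoC 0) < 1) by (rewrite Cmod_0; lra).
assert (Ha : has_ps a 1 h) by (apply has_ps_expansion; exact Ea).
set (b' := coeff_shift (fun n => b (S n))).
assert (Hb : has_ps b' 1 g).
{ intros u Hu. specialize (Eb u Hu). apply is_series_sums in Eb.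
  replace (g u) with (Cplus (Cmult (b' O) (Cpow u 0)) (g u)) by (simpl; ring).
  exact (sums_S (fun n => Cmult (b' n) (Cpow u n)) _ Eb). }
assert (Hd : forall u, Cmod u < 1 -> 0 < Cmod (C_derive h u)).
{ intros u Hu. specialize (Hlu u Hu).
  generalize (Cmod_ge_0 (C_derive h u)) (Cmod_ge_0 (C_derive g u)); intros.
  destruct (Req_dec (Cmod (C_derive h u)) 0) as [E0|]; [rewrite E0 in Hlu; nra|lra]. }
assert (Hgh : forall u, Cmod u < 1 -> Cmod (C_derive g u) <= k * Cmod (C_derive h u)).
{ intros u Hu. specialize (Hqc u Hu). rewrite Cmod_div in Hqc by (apply Cmod_gt_0, Hd, Hu).
  apply Rle_div_l in Hqc; [exact Hqc|apply Hd, Hu]. }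
assert (Hlt : forall u, Cmod u < 1 -> Cmod (h u) < 1).
{ intros u Hu. apply lt_1_of_derive_neq_0; try assumption. apply Cmod_gt_0, Hd, Hu. }
assert (Ea0 : h (RtoC 0) = a O) by (apply (has_ps_0 a 1 h); [lra|exact Ha]).
set (A := Cmod (a O)).
assert (HA : 0 <= A < 1) by (unfold A; rewrite <- Ea0; split; [apply Cmod_ge_0|apply Hlt, H0]).
assert (Hcoef : forall n, (1 <= n)%nat -> Cmod (a n) <= 1 - A ^ 2).
{ intros n Hn. apply (bounded_coeff_le a h n Ha Hsup); [apply HA|exact Hn]. }
assert (HS : forall j, (1 <= j)%nat -> Cmod (w j z) <= r ^ j).
{ intros j Hj. apply Rle_trans with (Cmod z ^ j).
  - apply schwarz; [apply Hw, Hj|lra].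
  - apply pow_incr; split; [apply Cmod_ge_0|exact Hz]. }
pose proof (pow_unit_interval r m ltac:(lra) Hm) as Hrm.
pose proof (pow_unit_interval r p ltac:(lra) Hp) as Hrp.
assert (Hrp0 : 0 < r ^ p) by (apply pow_lt; lra).
pose proof (HS m Hm) as Hwm. pose proof (HS p Hp) as Hwp. pose proof (HS q Hq) as Hwq.
set (T := r ^ p) in *.
set (zeta := w m z) in *.
assert (Hzeta : Cmod zeta < 1) by lra.
pose proof (schwarz_pick_derive h zeta Hh Hsup Hzeta (Hlt _ Hzeta)) as SP1.
pose proof (schwarz_pick_at_0 h zeta Hh Hsup (Hlt _ H0) Hzeta) as SP2.
rewrite Ea0 in SP2. fold A in SP2.
assert (HX : 0 <= 1 - Cmod (h zeta) ^ 2).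
{ generalize (Cmod_ge_0 (h zeta)) (Hsup _ Hzeta); nra. }
pose proof (bohr_real_inequality k r m p q A (1 - Cmod (h zeta) ^ 2) (Cmod (C_derive h zeta))
  (Cmod zeta) (Cmod (w q z)) HA (conj (Cmod_ge_0 _) Hzeta) (Cmod_ge_0 _) (Cmod_ge_0 _) HX
  Hwm Hwq Hrm Hnum Hrad SP1 SP2) as HB.
fold T in HB.
assert (HA2 : 0 <= 1 - A ^ 2) by nra.
assert (S1 : Rbar_le (abs_sum 2 a (Cmod (w p z))) ((1 - A ^ 2) * (T * T / (1 - T)))).
{ apply abs_sum_le. intros n.
  apply Rle_trans with ((1 - A ^ 2) * T * rsum (fun i => T ^ S i) n).
  - rewrite <- rsum_scal. apply rsum_le; intros i _.
    replace ((1 - A ^ 2) * T * T ^ S i) with ((1 - A ^ 2) * T ^ (2 + i)) by (simpl; ring).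
    apply Rmult_le_compat; [apply Cmod_ge_0|apply pow_le, Cmod_ge_0|apply Hcoef; lia|].
    apply pow_incr; split; [apply Cmod_ge_0|exact Hwp].
  - replace ((1 - A ^ 2) * (T * T / (1 - T))) with ((1 - A ^ 2) * T * (T / (1 - T))) by (field; lra).
    apply Rmult_le_compat_l; [apply Rmult_le_pos; lra|apply rsum_geom_le; exact Hrp]. }
assert (S2 : Rbar_le (abs_sum 1 b (Cmod (w p z))) (k * (1 - A ^ 2) * (T / (1 - T)))).
{ apply abs_sum_le. intros n.
  apply Rle_trans with (rsum (fun i => Cmod (b' (S i)) * T ^ S i) n).
  - apply rsum_le; intros i _. apply Rmult_le_compat_l; [apply Cmod_ge_0|].
    apply pow_incr; split; [apply Cmod_ge_0|exact Hwp].
  - apply (dilatation_coeff_sum k a b' h g); try assumption; lra. }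
unfold bohr_sum. fold zeta.
eapply Rbar_le_trans; [apply Rbar_plus_le_compat;
  [apply Rbar_plus_le_compat; [apply Rbar_le_refl|exact S1]|exact S2]|].
simpl Rbar_plus. unfold Rbar_le.
replace ((1 - A ^ 2) * ((T + k) * T / (1 - T))) with
  ((1 - A ^ 2) * (T * T / (1 - T)) + k * (1 - A ^ 2) * (T / (1 - T))) in HB by (field; lra).
lra.
Qed.

(** * Sharpness *)

Section Extremal.

Variables (k x : R).
Hypothesis Hk : 0 <= k < 1.
Hypothesis Hx : 0 < x < 1.

(** The automorphism of the disc taking 0 to [x]: equality holds for it in all the
    Schwarz--Pick bounds at positive reals, and its Taylor coefficients have moduli
    [(1 - x^2) x^n], nearly constant for [x] close to 1. *)
Definition moebius (z : C) : C :=
  Cmult (Cplus (RtoC x) (Cmult (RtoC 1) z)) (Cinv (Cplus (RtoC 1) (Cmult (RtoC x) z))).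

Definition moebius_coeff (n : nat) : C :=
  match n with O => RtoC x | S n => RtoC ((1 - x ^ 2) * (- x) ^ n) end.

(** The map [k (moebius - x)], whose dilatation is constantly [k]. *)
Definition comoebius (z : C) : C :=
  Cplus (Cmult (RtoC k) (moebius z)) (Cmult (RtoC (- (k * x))) (RtoC 1)).

Definition comoebius_coeff (n : nat) : C := Cmult (RtoC k) (moebius_coeff n).

Lemma moebius_denom_neq_0 z : Cmod z < 1 -> Cplus (RtoC 1) (Cmult (RtoC x) z) <> RtoC 0.
Proof.
intros Hz. replace (Cplus (RtoC 1) (Cmult (RtoC x) z)) with
  (Cminus (RtoC 1) (Cmult (Cconj (RtoC (- x))) z)) by (rewrite Cconj_R, RtoC_opp; ring).
apply one_minus_conj_mult_neq_0; [|lra]. rewrite Cmod_R, Rabs_Ropp, Rabs_pos_eq; lra.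
Qed.

Lemma moebius_local z : Cmod z < 1 -> exists c rho, 0 < rho /\
  has_ps c rho (fun u => moebius (Cplus z u)) /\
  c 1%nat = Cdiv (RtoC (1 - x ^ 2)) (Cpow (Cplus (RtoC 1) (Cmult (RtoC x) z)) 2).
Proof.
intros Hz. pose proof (moebius_denom_neq_0 z Hz) as Hp.
set (p := Cplus (RtoC 1) (Cmult (RtoC x) z)) in *.
assert (Hp0 : 0 < Cmod p) by (apply Cmod_gt_0; exact Hp).
assert (Hrho : 0 < Cmod p / x) by (apply Rdiv_lt_0_compat; lra).
pose proof (has_ps_geom p (RtoC x) (Cmod p / x) Hp Hrho) as HG.
assert (HG' := HG ltac:(rewrite Cmod_R, Rabs_pos_eq by lra; right; field; lra)). clear HG.
apply (has_ps_affine_mul (Cplus (RtoC x) z) (RtoC 1)) in HG'.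
eexists; exists (Cmod p / x). split; [exact Hrho|]. split.
- eapply has_ps_ext; [|exact HG']. intros u _. unfold moebius, p. cbv beta.
  replace (Cplus (RtoC x) (Cmult (RtoC 1) (Cplus z u))) with
    (Cplus (Cplus (RtoC x) z) (Cmult (RtoC 1) u)) by ring.
  f_equal. f_equal. ring.
- cbn [coeff_shift]. rewrite RtoC_minus, RtoC_pow. simpl Cpow.
  assert (E : Cplus (RtoC 1) (Cmult (RtoC x) z) = p) by reflexivity.
  replace (Cplus (RtoC x) z) with (Cdiv (Cminus (Cplus p (Cmult (RtoC x) (RtoC x))) (RtoC 1)) (RtoC x)).
  + field. split; [exact Hp|]. intros E'; injection E'; lra.
  + rewrite <- E. field. intros E'; injection E'; lra.
Qed.

Lemma moebius_ps : has_ps moebius_coeff 1 moebius.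
Proof.
pose proof (has_ps_geom (RtoC 1) (RtoC x) 1 C1_nz Rlt_0_1) as HG.
assert (HG' := HG ltac:(rewrite Cmod_1, Cmod_R, Rabs_pos_eq by lra; lra)). clear HG.
apply (has_ps_affine_mul (RtoC x) (RtoC 1)) in HG'.
intros u Hu. eapply sums_ext; [|exact (HG' u Hu)].
intros n. cbv beta. f_equal.
assert (E : forall i, Cdiv (Cpow (Copp (Cdiv (RtoC x) (RtoC 1))) i) (RtoC 1) = RtoC ((- x) ^ i)).
{ intros i. rewrite RtoC_pow, RtoC_opp.
  replace (Copp (Cdiv (RtoC x) (RtoC 1))) with (Copp (RtoC x)) by field. field. }
destruct n as [|n]; unfold coeff_shift, moebius_coeff; rewrite !E.
- simpl. ring.
- simpl pow. rewrite !RtoC_mult, RtoC_minus, !RtoC_mult, RtoC_opp. ring.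
Qed.

Lemma moebius_derive z : Cmod z < 1 ->
  C_derive moebius z = Cdiv (RtoC (1 - x ^ 2)) (Cpow (Cplus (RtoC 1) (Cmult (RtoC x) z)) 2).
Proof.
intros Hz. destruct (moebius_local z Hz) as (c & rho & Hr & H & E).
rewrite <- E. exact (C_derive_ps c rho moebius z Hr H).
Qed.

Lemma comoebius_derive z : Cmod z < 1 -> C_derive comoebius z = Cmult (RtoC k) (C_derive moebius z).
Proof.
intros Hz. destruct (moebius_local z Hz) as (c & rho & Hr & H & E).
rewrite (C_derive_ps c rho moebius z Hr H).
pose proof (has_ps_lin (RtoC k) (RtoC (- (k * x))) _ _ _ _ _ H (has_ps_const (RtoC 1) rho)) as HL.
change (has_ps (fun n => Cplus (Cmult (RtoC k) (c n)) (Cmult (RtoC (- (k * x))) (coeff_const (RtoC 1) n)))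
  rho (fun u => comoebius (Cplus z u))) in HL.
rewrite (C_derive_ps _ rho comoebius z Hr HL). simpl. ring.
Qed.

Lemma moebius_analytic z : Cmod z < 1 -> analytic_at moebius z.
Proof.
intros Hz. destruct (moebius_local z Hz) as (c & rho & Hr & H & E). exists c, rho; auto.
Qed.

Lemma comoebius_analytic z : Cmod z < 1 -> analytic_at comoebius z.
Proof.
intros Hz. apply (analytic_at_lin (RtoC k) (RtoC (- (k * x))) moebius (fun _ => RtoC 1));
  [apply moebius_analytic, Hz|apply analytic_at_const].
Qed.

Lemma moebius_le_1 z : Cmod z < 1 -> Cmod (moebius z) <= 1.
Proof.
intros Hz. pose proof (moebius_denom_neq_0 z Hz) as Hp.
assert (Hp0 : 0 < Cmod (Cplus (RtoC 1) (Cmult (RtoC x) z))) by (apply Cmod_gt_0; exact Hp).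
unfold moebius. rewrite Cmod_mult, Cmod_inv by exact Hp.
apply Rle_div_l; [exact Hp0|]. rewrite Rmult_1_l.
generalize (pick_identity (RtoC (- x)) z).
replace (Cminus (RtoC 1) (Cmult (Cconj (RtoC (- x))) z)) with (Cplus (RtoC 1) (Cmult (RtoC x) z))
  by (rewrite Cconj_R, RtoC_opp; ring).
replace (Cminus z (RtoC (- x))) with (Cplus (RtoC x) (Cmult (RtoC 1) z)) by (rewrite RtoC_opp; ring).
rewrite Cmod_R, Rabs_Ropp, Rabs_pos_eq by lra. intros E.
generalize (Cmod_ge_0 z); intros.
assert (0 <= (1 - x ^ 2) * (1 - Cmod z ^ 2)) by (apply Rmult_le_pos; nra).
apply Rsqr_incr_0; unfold Rsqr; [lra|apply Cmod_ge_0|lra].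
Qed.

Lemma pow_class_Bj j : class_Bj j (fun z => Cpow z j).
Proof.
assert (H : has_ps (Nat.iter j coeff_shift (coeff_const (RtoC 1))) 1 (fun z => Cpow z j)).
{ apply has_ps_ext with (fun u => Cmult (Cpow u j) (RtoC 1)); [intros u _; ring|].
  apply (has_ps_shift_iter j _ 1 (fun _ => RtoC 1)), has_ps_const. }
split; [split|split].
- apply analytic_on_disc_at. intros z _. apply analytic_at_pow.
- apply sup_norm_le_1. intros z Hz. rewrite Cmod_pow, <- (pow1 j).
  apply pow_incr. split; [apply Cmod_ge_0|lra].
- intros i Hi. rewrite (C_derive_n_0 _ 1 _ i Rlt_0_1 H), coeff_shift_iter_lt by exact Hi. ring.
- rewrite (C_derive_n_0 _ 1 _ j Rlt_0_1 H).
  generalize (coeff_shift_iter_ge j (coeff_const (RtoC 1)) 0). rewrite Nat.add_0_r. intros ->.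
  apply Cmult_neq_0; [|exact C1_nz]. intros E; injection E; apply INR_fact_neq_0.
Qed.

Lemma moebius_admissible K : k = kappa K ->
  admissible K (fun z => Cplus (moebius z) (Cconj (comoebius z))) moebius comoebius
    moebius_coeff comoebius_coeff (fun j z => Cpow z j).
Proof.
intros EK.
assert (Hd : forall z, Cmod z < 1 -> 0 < Cmod (C_derive moebius z)).
{ intros z Hz. apply Cmod_gt_0. rewrite moebius_derive by exact Hz.
  pose proof (moebius_denom_neq_0 z Hz) as Hp. unfold Cdiv. apply Cmult_neq_0.
  - intros E; injection E; nra.
  - intros E. apply C1_nz. rewrite <- (Cinv_r (Cpow (Cplus (RtoC 1) (Cmult (RtoC x) z)) 2)).
    + rewrite E; ring.
    + apply Cpow_nz, Hp. }
split; [|split; [|split; [|split]]].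
- split; [|split].
  + split; [apply analytic_on_disc_at; exact moebius_analytic|].
    split; [apply analytic_on_disc_at; exact comoebius_analytic|reflexivity].
  + intros z Hz. rewrite comoebius_derive by exact Hz. specialize (Hd z Hz).
    rewrite Cmod_mult, Cmod_R, Rabs_pos_eq by lra.
    replace (_ - _) with ((1 - k ^ 2) * Cmod (C_derive moebius z) ^ 2) by ring.
    apply Rmult_lt_0_compat; [nra|apply pow_lt; exact Hd].
  + intros z Hz. rewrite comoebius_derive by exact Hz. specialize (Hd z Hz).
    assert (Hd' : C_derive moebius z <> RtoC 0) by (apply Cmod_gt_0; exact Hd).
    rewrite Cmod_div, Cmod_mult, Cmod_R, Rabs_pos_eq by (exact Hd' || lra).
    rewrite <- EK. right; field; lra.
- intros z Hz. apply is_series_sums. exact (moebius_ps z Hz).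
- intros z Hz. apply is_series_sums.
  pose proof (sums_scal (RtoC k) _ _ (sums_unS _ _ (moebius_ps z Hz))) as HS.
  replace (comoebius z) with
    (Cmult (RtoC k) (Cminus (moebius z) (Cmult (moebius_coeff 0) (Cpow z 0)))).
  + eapply sums_ext; [|exact HS]. intros n. cbv beta. unfold comoebius_coeff. change (1 + n)%nat with (S n). ring.
  + unfold comoebius. rewrite RtoC_opp, RtoC_mult. simpl. ring.
- apply sup_norm_le_1. exact moebius_le_1.
- intros j _. apply pow_class_Bj.
Qed.

Lemma abs_sum_geom N c t A y : 0 <= y * t < 1 -> 0 <= y -> 0 <= t ->
  (forall n, Cmod (c (N + n)%nat) = A * y ^ n) ->
  abs_sum N c t = Finite (A * t ^ N / (1 - y * t)).
Proof.
intros Hyt Hy Ht Hc. unfold abs_sum. apply is_lim_seq_unique.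
change (is_series (fun n => Cmod (c (N + n)%nat) * t ^ (N + n)) (A * t ^ N / (1 - y * t))).
apply is_series_ext with (fun n => scal (A * t ^ N) ((y * t) ^ n)).
- intros n. rewrite Hc. unfold scal; simpl; unfold mult; simpl. rewrite pow_add, Rpow_mult_distr. ring.
- apply (is_series_scal (K := R_AbsRing) (V := R_NormedModule) (A * t ^ N)).
  apply is_series_geom. rewrite Rabs_pos_eq; lra.
Qed.

Lemma moebius_bohr_sum m p q R : 0 < R < 1 -> (1 <= m)%nat -> (1 <= p)%nat ->
  bohr_sum m p q moebius moebius_coeff comoebius_coeff (fun j z => Cpow z j) (RtoC R) =
  Finite (1 + (1 - x ^ 2) * ((x * R ^ p + k) * R ^ p / (1 - x * R ^ p) -
     radius_num m q R / (1 + x * R ^ m) ^ 2)).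
Proof.
intros HR Hm Hp. unfold bohr_sum.
pose proof (pow_unit_interval R m ltac:(lra) Hm) as Hm1.
pose proof (pow_unit_interval R p ltac:(lra) Hp) as Hp1.
assert (Hq0 : 0 <= R ^ q) by (apply pow_le; lra).
rewrite <- !RtoC_pow.
assert (Habs : forall n, Cmod (RtoC (R ^ n)) = R ^ n).
{ intros n; rewrite Cmod_R; apply Rabs_pos_eq, pow_le; lra. }
rewrite !Habs.
assert (Hc : forall n, Cmod (moebius_coeff (S n)) = (1 - x ^ 2) * x ^ n).
{ intros n. unfold moebius_coeff. rewrite Cmod_R, Rabs_mult, <- RPow_abs, Rabs_Ropp.
  rewrite !Rabs_pos_eq by nra. reflexivity. }
rewrite (abs_sum_geom 2 moebius_coeff (R ^ p) ((1 - x ^ 2) * x) x).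
2: nra. 2: lra. 2: lra.
2:{ intros n. change (2 + n)%nat with (S (S n)). rewrite Hc. simpl. ring. }
rewrite (abs_sum_geom 1 comoebius_coeff (R ^ p) (k * (1 - x ^ 2)) x).
2: nra. 2: lra. 2: lra.
2:{ intros n. change (1 + n)%nat with (S n). unfold comoebius_coeff.
    rewrite Cmod_mult, Hc, Cmod_R, Rabs_pos_eq by lra. ring. }
assert (Hden : 0 < 1 + x * R ^ m) by nra.
assert (E1 : Cmod (moebius (RtoC (R ^ m))) = (x + R ^ m) / (1 + x * R ^ m)).
{ unfold moebius. rewrite Cmult_1_l, <- RtoC_mult, <- !RtoC_plus, <- RtoC_inv, <- RtoC_mult by lra.
  rewrite Cmod_R, Rabs_pos_eq; [reflexivity|]. apply Rdiv_le_0_compat; lra. }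
assert (E2 : Cmod (C_derive moebius (RtoC (R ^ m))) = (1 - x ^ 2) / (1 + x * R ^ m) ^ 2).
{ rewrite moebius_derive by (rewrite Habs; lra).
  rewrite <- RtoC_mult, <- RtoC_plus, <- RtoC_pow, <- RtoC_div by (apply pow_nonzero; lra).
  rewrite Cmod_R, Rabs_pos_eq; [reflexivity|]. apply Rdiv_le_0_compat; [nra|apply pow_lt; lra]. }
rewrite E1, E2. simpl Rbar_plus. f_equal.
unfold radius_num. replace (R ^ (2 * m)) with ((R ^ m) ^ 2) by (rewrite <- pow_mult, Nat.mul_comm; reflexivity).
field. split; nra.
Qed.

End Extremal.

(** As [x] tends to 1 the excess of the extremal sum over 1, divided by [1 - x^2], tends
    to the value of [radius_fun]. *)
Lemma extremal_parameter m p q k R : (1 <= m)%nat -> (1 <= p)%nat -> 0 <= k < 1 -> 0 < R < 1 ->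
  0 < radius_fun m p q k R -> exists x, 0 < x < 1 /\
  0 < (x * R ^ p + k) * R ^ p / (1 - x * R ^ p) - radius_num m q R / (1 + x * R ^ m) ^ 2.
Proof.
intros Hm Hp Hk HR Hpos. apply NNPP. intros Hno.
pose proof (pow_unit_interval R m ltac:(lra) Hm) as Hm1.
pose proof (pow_unit_interval R p ltac:(lra) Hp) as Hp1.
set (phi := fun x => radius_num m q R / (1 + x * R ^ m) ^ 2 - (x * R ^ p + k) * R ^ p / (1 - x * R ^ p)).
assert (H : 0 <= phi 1).
{ apply (le_limit_at_1 phi 0 0); [lra| |].
  - apply ex_derive_continuity_pt. unfold phi; auto_derive.
    repeat split; try lra. apply Rgt_not_eq; nra.
  - intros x Hx. apply Rnot_lt_le. intros Hlt. apply Hno. exists x. split; [exact Hx|].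
    unfold phi in Hlt. lra. }
unfold phi in H. unfold radius_fun in Hpos. fold (radius_num m q R) in Hpos.
rewrite !Rmult_1_l in H. lra.
Qed.

Theorem theorem3p3 :
  forall (K : R) (m p q : nat),
    1 <= K -> (1 <= m)%nat -> (1 <= p)%nat -> (1 <= q)%nat ->
    exists R2 r : R,
      is_R2 m q R2 /\
      is_radius m p q (kappa K) r /\
      r <= R2 /\
      (forall (f h g : C -> C) (a b : nat -> C) (w : nat -> C -> C),
         admissible K f h g a b w ->
         forall z : C, Cmod z <= r ->
           Rbar_le (bohr_sum m p q h a b w z) (Finite 1)) /\
      (forall R' : R, r < R' < 1 ->
         exists (f h g : C -> C) (a b : nat -> C) (w : nat -> C -> C),
           admissible K f h g a b w /\
           exists z : C, Cmod z <= R' /\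
             ~ Rbar_le (bohr_sum m p q h a b w z) (Finite 1)).
Proof.
intros K m p q HK Hm Hp Hq.
pose proof (kappa_bounds K HK) as Hk.
destruct (R2_exists m q Hm Hq) as [R2 HR2].
destruct (radius_exists m p q (kappa K) R2 Hm Hp Hq (proj1 Hk) HR2) as (r & Hrad & HrR2).
exists R2, r. split; [exact HR2|]. split; [exact Hrad|]. split; [exact HrR2|].
destruct Hrad as (Hr & Er & _).
assert (Hnum : 0 <= radius_num m q r).
{ destruct HR2 as [[H1 E] _]. fold (radius_num m q R2) in E. rewrite <- E.
  destruct HrR2 as [Hlt| ->]; [|lra]. apply Rlt_le, radius_num_decr; try assumption; lra. }
split.
- intros f h g a b w Hadm z Hz.
  exact (admissible_bohr_le K m p q f h g a b w r z HK Hm Hp Hq Hr Er Hnum Hadm Hz).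
- intros R' HR'.
  assert (Hpos : 0 < radius_fun m p q (kappa K) R').
  { rewrite <- Er. apply radius_fun_incr; try assumption; lra. }
  destruct (extremal_parameter m p q (kappa K) R' Hm Hp Hk ltac:(lra) Hpos) as (x & Hx & Hexc).
  exists (fun z => Cplus (moebius x z) (Cconj (comoebius (kappa K) x z))), (moebius x),
    (comoebius (kappa K) x), (moebius_coeff x), (comoebius_coeff (kappa K) x), (fun j z => Cpow z j).
  split; [apply moebius_admissible; auto|].
  exists (RtoC R'). split; [rewrite Cmod_R, Rabs_pos_eq; lra|].
  rewrite moebius_bohr_sum by (assumption || lra). unfold Rbar_le. apply Rlt_not_le.
assert (Hx2 : 0 < 1 - x ^ 2) by nra. generalize (Rmult_lt_0_compat _ _ Hx2 Hexc). lra.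
Qed.
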